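(* There exist two finitely generated groups $\Gamma_1$ and $\Gamma_2$ of (orientation preserving) $C^{\infty}$ diffeomorphisms of the circle $\mathrm{S}^1$, each acting non freely and without finite orbits on $\mathrm{S}^1$, such that $\Gamma_1$ and $\Gamma_2$ are conjugate by a bi-Lipschitz (orientation preserving) homeomorphism, i.e. there is a bi-Lipschitz homeomorphism $\phi : \mathrm{S}^1 \to \mathrm{S}^1$ with $\phi\, \Gamma_1\, \phi^{-1} = \Gamma_2$, but there is no (orientation preserving) $C^1$ circle diffeomorphism $\psi$ with $\psi\, \Gamma_1\, \psi^{-1} = \Gamma_2$.
   Context: A homeomorphism $\phi$ of $\mathrm{S}^1$ is bi-Lipschitz if both $\phi$ and $\phi^{-1}$ are Lipschitz. A group $\Gamma$ of circle homeomorphisms acts non freely if some element $g \in \Gamma$, $g \neq \mathrm{id}$, has a fixed point on $\mathrm{S}^1$; it acts without finite orbits if for every $x \in \mathrm{S}^1$ the orbit $\{g(x) : g \in \Gamma\}$ is infinite. *)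

(* Defs.v *)
From Stdlib Require Import Reals List Lra.
From Coquelicot Require Import Coquelicot.
Open Scope R_scope.

(* The circle S^1, with the metric induced by the complex plane.  The chordal
   and arc-length metrics are bi-Lipschitz equivalent, so the choice does not
   affect which maps are Lipschitz. *)
Definition circle : Type := {z : C | Cmod z = 1}.

Definition circle_dist (p q : circle) : R :=
  Cmod (Cminus (proj1_sig p) (proj1_sig q)).

Lemma Cmod_cos_sin (t : R) : Cmod (cos t, sin t) = 1.
Proof.
unfold Cmod; simpl fst; simpl snd.
replace (cos t ^ 2 + sin t ^ 2) with 1; [exact sqrt_1 |].
generalize (sin2_cos2 t); unfold Rsqr; lra.
Qed.

(* The universal covering, inducing R/Z = S^1. *)
Definition cover (t : R) : circle :=
  exist (fun z : C => Cmod z = 1)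
    (cos (2 * PI * t), sin (2 * PI * t)) (Cmod_cos_sin (2 * PI * t)).

Definition lift_of (F : R -> R) (f : circle -> circle) : Prop :=
  (forall t, continuous F t) /\ (forall t, f (cover t) = cover (F t)).

Definition orientation_preserving (f : circle -> circle) : Prop :=
  exists F, lift_of F f /\ (forall s t, s < t -> F s < F t).

Definition Ck_real (k : nat) (F : R -> R) : Prop :=
  (forall n t, (n <= k)%nat -> ex_derive_n F n t) /\
  (forall t, continuous (Derive_n F k) t).

(* The local inverses of [cover] are the charts of S^1, so a circle map is C^k
   when it has a C^k lift.  All continuous lifts of a map differ by constants. *)
Definition Ck_map (k : nat) (f : circle -> circle) : Prop :=
  exists F, lift_of F f /\ Ck_real k F.

Definition smooth_map (f : circle -> circle) : Prop := forall k, Ck_map k f.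

Definition lipschitz (f : circle -> circle) : Prop :=
  exists L : R, forall p q, circle_dist (f p) (f q) <= L * circle_dist p q.

Definition inverses (f g : circle -> circle) : Prop :=
  (forall x, g (f x) = x) /\ (forall y, f (g y) = y).

Definition invertible_with (P : (circle -> circle) -> Prop)
    (f : circle -> circle) : Prop :=
  exists g, inverses f g /\ P f /\ P g.

Definition Ck_diffeo (k : nat) := invertible_with (Ck_map k).
Definition smooth_diffeo := invertible_with smooth_map.

(* Lipschitz maps are continuous, so these are homeomorphisms. *)
Definition bilipschitz_homeo := invertible_with lipschitz.

Definition is_group (G : (circle -> circle) -> Prop) : Prop :=
  G (fun x => x) /\
  (forall f g, G f -> G g -> G (fun x => f (g x))) /\
  (forall f, G f -> exists g, G g /\ inverses f g).

(* G is the smallest group containing some finite list of its elements. *)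
Definition finitely_generated (G : (circle -> circle) -> Prop) : Prop :=
  exists l : list (circle -> circle),
    (forall f, In f l -> G f) /\
    (forall H : (circle -> circle) -> Prop,
       is_group H -> (forall f, In f l -> H f) -> forall f, G f -> H f).

Definition smooth_diffeo_group (G : (circle -> circle) -> Prop) : Prop :=
  is_group G /\
  (forall f, G f -> smooth_diffeo f /\ orientation_preserving f).

Definition acts_non_freely (G : (circle -> circle) -> Prop) : Prop :=
  exists g, G g /\ g <> (fun x => x) /\ exists x, g x = x.

Definition finite_subset (A : circle -> Prop) : Prop :=
  exists l : list circle, forall y, A y -> In y l.

Definition orbit (G : (circle -> circle) -> Prop) (x : circle) : circle -> Prop :=
  fun y => exists g, G g /\ y = g x.

Definition without_finite_orbits (G : (circle -> circle) -> Prop) : Prop :=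
  forall x, ~ finite_subset (orbit G x).

(* phi G1 phi^-1 = G2 *)
Definition conjugates (phi : circle -> circle)
    (G1 G2 : (circle -> circle) -> Prop) : Prop :=
  exists phi', inverses phi phi' /\
    forall g, G2 g <-> exists f, G1 f /\ g = (fun x => phi (f (phi' x))).

(* Main.v *)
(* Let f be a hyperbolic Moebius map of the circle with fixed points 1 and -1,
   and s an elliptic involution in ping-pong position with f, so that the upper
   half circle is a component of the complement of the limit set of <f, s>.
   Put f_2 = f k, where k is a smooth diffeomorphism supported in a fundamental
   domain D of f in the upper half circle; the groups are <f, s> and <f_2, s>.

   They are conjugate by the homeomorphism phi that equals g k g^-1 on g(D), for
   the reduced words g ending in a positive power of f, and the identity
   elsewhere.  The arcs g(D) are disjoint and, by ping-pong, the maps g have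
   uniformly bounded distortion on D, so phi is bi-Lipschitz.

   A C^1 conjugacy would conjugate f_2 to an element of <f, s>, that is, to a
   Moebius map with two fixed points.  Differentiability at the two fixed points
   forces it to be linear, in linearizing coordinates, on both sides of D, and
   this is incompatible with k being nontrivial. *)
Require Import Defs.
From Stdlib Require Import Reals List Lra Lia ZArith Classical ClassicalEpsilon
  FunctionalExtensionality ProofIrrelevance FinFun.
From Coquelicot Require Import Coquelicot.
Open Scope R_scope.

(** * Smooth functions on the line *)

(** Two devices carry the proof. First, a Moebius map [g] enters only through the identity
    [|g z - g w| = |z - w| d(z) d(w)], which composes without any formula for words. Comparison with
    one reference point turns it into the uniform distortion bound. Applied to two fixed points [P]
    and [Q], it shows that [|z - P| / |z - Q|] is multiplied by a constant, which linearizes an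
    otherwise unknown element of the first group. Second, ping-pong is read off one real function,
    the height (imaginary part). In the coordinate [x = tan (PI * t)], f is [x -> 9 x], and
    [1/3 < |x| < 3], that is [|height| > 3/5], gives a fundamental domain on each half circle. The
    involution s, with multiplier 16, sends everything outside the lower domain strictly inside it,
    to height at most -63/65; this margin leaves room for the reference point, at height -15/17.
    Since f and f_2 agree on the lower half circle, the fixed point and the infinite orbits are
    found there, once for both groups. *)

Definition flat (n : nat) (x : R) : R :=
  if Rlt_dec 0 x then (/ x) ^ n * exp (- / x) else 0.

(* A class of functions stable under differentiation, hence of C^infinity
   functions; it avoids the formulas for higher derivatives. *)
Inductive Sm : (R -> R) -> Prop :=
| Sm_const c : Sm (fun _ => c)
| Sm_id : Sm (fun t => t)
| Sm_plus f g : Sm f -> Sm g -> Sm (fun t => f t + g t)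
| Sm_mult f g : Sm f -> Sm g -> Sm (fun t => f t * g t)
| Sm_comp f g : Sm f -> Sm g -> Sm (fun t => f (g t))
| Sm_inv f : Sm f -> (forall t, f t <> 0) -> Sm (fun t => / f t)
| Sm_sin : Sm sin
| Sm_cos : Sm cos
| Sm_atan : Sm atan
| Sm_flat n : Sm (flat n)
| Sm_recip f f' g : Sm f' -> (forall t, is_derive f t (f' t)) ->
    (forall t, f' t <> 0) -> (forall s t, s < t -> f s < f t) ->
    (forall y, f (g y) = y) -> Sm g
| Sm_ext f g : (forall t, f t = g t) -> Sm f -> Sm g.

#[local] Hint Resolve Sm_const Sm_id Sm_sin Sm_cos Sm_atan Sm_flat : core.

(** Raise [y / m <= exp (y / m)] to the power [m]. *)
Lemma pow_le_exp (m : nat) (y : R) :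
  0 <= y -> y ^ m <= INR m ^ m * exp y.
Proof.
intros Hy. destruct m as [|m].
- simpl. generalize (exp_ineq1_le y). lra.
- set (n := INR (S m)).
  assert (Hn : 0 < n) by (apply lt_0_INR; lia).
  assert (Hyn : 0 <= y / n)
    by (apply Rmult_le_pos; [lra | left; apply Rinv_0_lt_compat; lra]).
  replace (exp y) with (exp (y / n) ^ S m).
  + rewrite <- Rpow_mult_distr. apply pow_incr. split; [lra |].
    replace y with (n * (y / n)) at 1 by (field; lra).
    apply Rmult_le_compat_l; [lra |].
    generalize (exp_ineq1_le (y / n)). lra.
  + assert (Hpow : forall k x, exp x ^ k = exp (INR k * x)).
    { induction k as [|k IH]; intros x.
      - simpl. rewrite Rmult_0_l, exp_0. reflexivity.
      - rewrite S_INR. simpl pow. rewrite IH, <- exp_plus. f_equal. ring. }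
    rewrite Hpow. f_equal. fold n. field. lra.
Qed.

Lemma flat_bound (n : nat) (x : R) : 0 <= flat n x <= INR n ^ n.
Proof.
assert (H0 : 0 <= INR n ^ n) by (apply pow_le, pos_INR).
unfold flat. destruct (Rlt_dec 0 x) as [Hx | Hx]; [| lra].
assert (Hi : 0 < / x) by (apply Rinv_0_lt_compat; lra).
assert (He : 0 < exp (- / x)) by apply exp_pos.
split.
- apply Rmult_le_pos; [apply pow_le; lra | lra].
- apply Rle_trans with (INR n ^ n * exp (/ x) * exp (- / x)).
  + apply Rmult_le_compat_r; [lra | apply pow_le_exp; lra].
  + rewrite Rmult_assoc, <- exp_plus, Rplus_opp_r, exp_0. lra.
Qed.

(** Two powers of [/ x] are traded for the factor [x ^ 2]; a quadratic bound yields the derivative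
    at 0. *)
Lemma flat_quadratic (n : nat) (x : R) :
  flat n x <= INR (n + 2) ^ (n + 2) * x ^ 2.
Proof.
replace (flat n x) with (flat (n + 2) x * x ^ 2).
- apply Rmult_le_compat_r; [apply pow2_ge_0 | apply flat_bound].
- unfold flat. destruct (Rlt_dec 0 x); [| ring].
  rewrite pow_add. field. lra.
Qed.

Lemma is_derive_quadratic_0 (f : R -> R) (C : R) :
  (forall x, Rabs (f x) <= C * x ^ 2) -> is_derive f 0 0.
Proof.
intros Hf. apply is_derive_Reals.
assert (HC : 0 <= C).
{ generalize (Hf 1) (Rabs_pos (f 1)). lra. }
assert (H0 : f 0 = 0).
{ generalize (Hf 0) (Rabs_pos (f 0)). intros H1 H2.
  destruct (Req_dec (f 0) 0) as [E | E]; [exact E |].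
  generalize (Rabs_pos_lt _ E). simpl in H1. lra. }
intros eps Heps.
(* [C + 1] instead of [C], which may be 0. *)
assert (Hd : 0 < eps / (C + 1)) by (apply Rdiv_lt_0_compat; lra).
exists (mkposreal _ Hd). simpl. intros h Hh Hlt.
rewrite Rplus_0_l, H0, !Rminus_0_r. unfold Rdiv. rewrite Rabs_mult, Rabs_inv.
assert (Hp := Rabs_pos_lt _ Hh).
apply Rmult_lt_reg_r with (Rabs h); [lra |].
rewrite Rmult_assoc, Rinv_l, Rmult_1_r by lra.
apply Rle_lt_trans with (1 := Hf h).
rewrite <- pow2_abs.
apply Rle_lt_trans with ((C * Rabs h) * Rabs h); [right; ring |].
apply Rmult_lt_compat_r; [lra |].
apply Rle_lt_trans with ((C + 1) * Rabs h); [nra |].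
apply Rmult_lt_reg_l with (/ (C + 1)); [apply Rinv_0_lt_compat; lra |].
rewrite <- Rmult_assoc, Rinv_l, Rmult_1_l by lra.
unfold Rdiv in Hlt. lra.
Qed.

(** The derivative stays in the span of the family: this is why the classical function [exp (- / x)]
    is accompanied by its products with powers of [/ x]. *)
Lemma is_derive_flat (n : nat) (x : R) :
  is_derive (flat n) x (flat (S (S n)) x - INR n * flat (S n) x).
Proof.
destruct (Rtotal_order x 0) as [Hx | [Hx | Hx]].
- replace (flat (S (S n)) x - INR n * flat (S n) x) with 0
    by (unfold flat; destruct (Rlt_dec 0 x); lra).
  apply is_derive_ext_loc with (fun _ => 0); [| apply @is_derive_const].
  assert (H : 0 < - x) by lra.
  exists (mkposreal _ H). intros y Hy. unfold flat.
  destruct (Rlt_dec 0 y) as [Hy0 |]; [| reflexivity].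
  apply Rabs_def2 in Hy. unfold minus, plus, opp in Hy; simpl in Hy. lra.
- subst x. replace (flat (S (S n)) 0 - INR n * flat (S n) 0) with 0
    by (unfold flat; destruct (Rlt_dec 0 0); lra).
  apply is_derive_quadratic_0 with (INR (n + 2) ^ (n + 2)).
  intros x. rewrite Rabs_pos_eq by apply flat_bound. apply flat_quadratic.
- apply is_derive_ext_loc with (fun x => (/ x) ^ n * exp (- / x)).
  + exists (mkposreal _ Hx). intros y Hy. unfold flat.
    destruct (Rlt_dec 0 y) as [|Hy0]; [reflexivity |].
    apply Rabs_def2 in Hy. unfold minus, plus, opp in Hy; simpl in Hy. lra.
  + unfold flat. destruct (Rlt_dec 0 x) as [_ |]; [| lra].
    auto_derive; [split; lra |].
    destruct n as [|n]; simpl pow; simpl Init.Nat.pred; [simpl; field; lra |].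
    field. lra.
Qed.

(** The preimages of [f t - eps] and [f t + eps] under an increasing surjection enclose a
    neighbourhood of [t]. This also serves for the conjugacy, which is only Lipschitz. *)
Lemma continuous_of_increasing (f g : R -> R) :
  (forall s t, s < t -> f s < f t) -> (forall y, f (g y) = y) ->
  forall t, continuous f t.
Proof.
intros Hf Hg t. apply continuity_pt_filterlim.
assert (Hinv : forall s t, f s < f t -> s < t).
{ intros a b Hab. destruct (Rle_lt_dec b a) as [[H | H] | H]; [| subst; lra | lra].
  generalize (Hf _ _ H). lra. }
intros eps Heps.
assert (H1 : g (f t - eps) < t) by (apply Hinv; rewrite Hg; lra).
assert (H2 : t < g (f t + eps)) by (apply Hinv; rewrite Hg; lra).
exists (Rmin (t - g (f t - eps)) (g (f t + eps) - t)). split.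
- apply Rmin_pos; lra.
- intros u [_ Hu]. simpl in Hu |- *. unfold R_dist in Hu |- *.
  assert (H3 := Rlt_le_trans _ _ _ Hu (Rmin_l _ _)).
  assert (H4 := Rlt_le_trans _ _ _ Hu (Rmin_r _ _)).
  apply Rabs_def2 in H3. apply Rabs_def2 in H4.
  assert (H5 : f (g (f t - eps)) < f u) by (apply Hf; lra).
  assert (H6 : f u < f (g (f t + eps))) by (apply Hf; lra).
  rewrite Hg in H5, H6. apply Rabs_def1; lra.
Qed.

Lemma increasing_inj (f : R -> R) :
  (forall s t, s < t -> f s < f t) -> forall s t, f s = f t -> s = t.
Proof.
intros Hf s t H. destruct (Rtotal_order s t) as [Hl | [He | Hl]].
- generalize (Hf _ _ Hl). lra.
- exact He.
- generalize (Hf _ _ Hl). lra.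
Qed.

Lemma increasing_recip (f g : R -> R) :
  (forall s t, s < t -> f s < f t) -> (forall y, f (g y) = y) ->
  forall s t, s < t -> g s < g t.
Proof.
intros Hf Hg s t Hst. destruct (Rle_lt_dec (g t) (g s)) as [[H | H] | H].
- apply Hf in H. rewrite !Hg in H. lra.
- assert (E : f (g t) = f (g s)) by congruence. rewrite !Hg in E. lra.
- exact H.
Qed.

Lemma is_derive_recip (f g : R -> R) (y l : R) :
  is_derive f (g y) l -> l <> 0 ->
  (forall s t, s < t -> f s < f t) -> (forall y, f (g y) = y) ->
  is_derive g y (/ l).
Proof.
intros Hd Hl Hf Hg.
assert (Hgf : forall x, g (f x) = x)
  by (intros x; apply (increasing_inj f Hf); apply Hg).
assert (Hc : continuous g y).
{ apply (continuous_of_increasing g f); [| exact Hgf].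
  exact (increasing_recip f g Hf Hg). }
apply is_derive_Reals in Hd. apply is_derive_Reals.
apply continuity_pt_filterlim in Hc.
intros eps Heps.
assert (Hal := Rabs_pos_lt _ Hl).
(* With [q] the difference quotient of [f], the first bound keeps [|q|] above [|l| / 2], and the
   second makes [|q - l| / (|q| |l|)], the error of [/ q], smaller than [eps]. *)
set (e := Rmin (Rabs l / 2) (eps * Rabs l * Rabs l / 4)).
assert (He : 0 < e).
{ apply Rmin_pos; [lra |]. apply Rdiv_lt_0_compat; [| lra].
  apply Rmult_lt_0_compat; [| lra]. apply Rmult_lt_0_compat; lra. }
destruct (Hd e He) as [del Hdel].
destruct (Hc del (cond_pos del)) as [a [Ha Hca]].
exists (mkposreal a Ha). simpl. intros h Hh Hha.
set (k := g (y + h) - g y).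
assert (Hk : k <> 0).
{ intros E. assert (E' : g (y + h) = g y) by (unfold k in E; lra).
  apply (f_equal f) in E'. rewrite !Hg in E'. lra. }
assert (Hkd : Rabs k < del).
{ apply (Hca (y + h)). split.
  - split; [exact I | lra].
  - simpl. unfold R_dist. replace (y + h - y) with h by ring. exact Hha. }
specialize (Hdel k Hk Hkd).
replace (g y + k) with (g (y + h)) in Hdel by (unfold k; ring).
rewrite !Hg in Hdel. replace (y + h - y) with h in Hdel by ring.
fold k.
set (q := h / k) in *.
assert (H1 := Rlt_le_trans _ _ _ Hdel (Rmin_l _ _)).
assert (H2 := Rlt_le_trans _ _ _ Hdel (Rmin_r _ _)).
assert (Hq : Rabs l / 2 < Rabs q).
{ generalize (Rabs_triang (l - q) q). replace (l - q + q) with l by ring.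
  rewrite (Rabs_minus_sym l q). lra. }
assert (Hq0 : q <> 0) by (intros E; rewrite E, Rabs_R0 in Hq; lra).
replace (k / h) with (/ q) by (unfold q; field; auto).
replace (/ q - / l) with ((l - q) * / (q * l)) by (field; auto).
rewrite Rabs_mult, Rabs_inv, Rabs_mult, (Rabs_minus_sym l q).
assert (Hql : 0 < Rabs q * Rabs l) by (apply Rmult_lt_0_compat; lra).
apply Rmult_lt_reg_r with (Rabs q * Rabs l); [exact Hql |].
rewrite Rmult_assoc, Rinv_l, Rmult_1_r by lra.
apply Rlt_trans with (1 := H2).
apply Rlt_le_trans with (eps * (Rabs l / 2 * Rabs l)).
- assert (0 < eps * (Rabs l * Rabs l))
    by (repeat apply Rmult_lt_0_compat; lra). nra.
- apply Rmult_le_compat_l; [lra |]. apply Rmult_le_compat_r; lra.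
Qed.

Lemma Sm_derive (f : R -> R) :
  Sm f -> exists f', Sm f' /\ forall t, is_derive f t (f' t).
Proof.
intros H. induction H as [c | | f g Hf [f' [Hf' Df]] Hg [g' [Hg' Dg]]
  | f g Hf [f' [Hf' Df]] Hg [g' [Hg' Dg]]
  | f g Hf [f' [Hf' Df]] Hg [g' [Hg' Dg]] | f Hf [f' [Hf' Df]] Hn | | | | n
  | f f' g Hf' IH Df Hn Hi Hfg | f g E Hf [f' [Hf' Df]]].
- exists (fun _ => 0). split; [auto |]. intros t. apply @is_derive_const.
- exists (fun _ => 1). split; [constructor |]. intros t. apply @is_derive_id.
- exists (fun t => f' t + g' t). split; [now apply Sm_plus |]. intros t.
  apply @is_derive_plus; auto.
- exists (fun t => f' t * g t + f t * g' t). split.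
  + apply Sm_plus; apply Sm_mult; assumption.
  + intros t. apply Derive.is_derive_mult; auto.
- exists (fun t => g' t * f' (g t)). split.
  + apply Sm_mult; [assumption |]. now apply (Sm_comp f' g).
  + intros t. apply (is_derive_comp f g t (f' (g t)) (g' t)); auto.
- exists (fun t => (-1) * f' t * (/ f t * / f t)). split.
  + apply Sm_mult; apply Sm_mult; auto; now apply Sm_inv.
  + intros t. replace (-1 * f' t * (/ f t * / f t)) with (- f' t / f t ^ 2)
      by (field; auto).
    apply is_derive_inv; auto.
- exists cos. split; [auto | exact is_derive_sin].
- exists (fun t => (-1) * sin t). split.
  + apply Sm_mult; auto.
  + intros t. replace (-1 * sin t) with (- sin t) by ring. apply is_derive_cos.
- exists (fun t => / (1 + t * t)). split.
  + apply Sm_inv; [| intros t; nra].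
    apply Sm_plus; [| apply Sm_mult]; auto.
  + exact is_derive_atan.
- exists (fun t => flat (S (S n)) t + (- INR n) * flat (S n) t). split.
  + apply Sm_plus; [| apply Sm_mult]; auto.
  + intros t.
    replace (flat (S (S n)) t + - INR n * flat (S n) t)
      with (flat (S (S n)) t - INR n * flat (S n) t) by ring.
    apply is_derive_flat.
- exists (fun t => / f' (g t)). split.
  + apply Sm_inv; [| intros t; apply Hn]. apply (Sm_comp f' g); [assumption |].
    now apply (Sm_recip f f' g).
  + intros t. now apply (is_derive_recip f).
- exists f'. split; [assumption |]. intros t.
  apply is_derive_ext with f; auto.
Qed.

Lemma Sm_ex_derive (f : R -> R) : Sm f -> forall t, ex_derive f t.
Proof.
intros H t. destruct (Sm_derive f H) as [f' [_ D]]. exists (f' t). apply D.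
Qed.

Lemma Sm_Derive_n (f : R -> R) (n : nat) : Sm f -> Sm (Derive_n f n).
Proof.
intros Hf. induction n as [|n IH]; [exact Hf |].
destruct (Sm_derive _ IH) as [f' [Hf' D]].
apply Sm_ext with f'; [| exact Hf'].
intros t. symmetry. apply is_derive_unique, D.
Qed.

Lemma Sm_Ck_real (f : R -> R) (k : nat) : Sm f -> Ck_real k f.
Proof.
intros Hf. split.
- intros [|n] t _; [exact I |]. apply Sm_ex_derive, Sm_Derive_n, Hf.
- intros t. apply (ex_derive_continuous (V := R_NormedModule)).
  apply Sm_ex_derive, Sm_Derive_n, Hf.
Qed.

Lemma Sm_continuous (f : R -> R) : Sm f -> forall t, continuous f t.
Proof.
intros H t. apply (ex_derive_continuous (V := R_NormedModule)).
now apply Sm_ex_derive.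
Qed.

(** * The circle and lifts of its maps *)

(* Half of the chordal distance between [cover s] and [cover t]. *)
Definition chord (s t : R) : R := Rabs (sin (PI * (s - t))).

Lemma chord_sym (s t : R) : chord s t = chord t s.
Proof.
unfold chord. replace (PI * (s - t)) with (- (PI * (t - s))) by ring.
now rewrite sin_neg, Rabs_Ropp.
Qed.

Lemma chord_nonneg (s t : R) : 0 <= chord s t.
Proof. apply Rabs_pos. Qed.

Lemma chord_le_1 (s t : R) : chord s t <= 1.
Proof. apply Rabs_le, SIN_bound. Qed.

Lemma Rabs_sin_plus (x y : R) :
  Rabs (sin (x + y)) <= Rabs (sin x) + Rabs (sin y).
Proof.
rewrite sin_plus. apply Rle_trans with (1 := Rabs_triang _ _).
rewrite !Rabs_mult.
assert (Hx : Rabs (cos x) <= 1) by (apply Rabs_le, COS_bound).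
assert (Hy : Rabs (cos y) <= 1) by (apply Rabs_le, COS_bound).
generalize (Rabs_pos (sin x)) (Rabs_pos (sin y)). nra.
Qed.

Lemma chord_triangle (s t u : R) : chord s u <= chord s t + chord t u.
Proof.
unfold chord. replace (PI * (s - u)) with (PI * (s - t) + PI * (t - u)) by ring.
apply Rabs_sin_plus.
Qed.

Lemma Rabs_sin_le (x : R) : Rabs (sin x) <= Rabs x.
Proof.
assert (H : forall y, 0 <= y -> Rabs (sin y) <= y).
{ intros y Hy. destruct (Rle_lt_dec y 1) as [H1 | H1].
  - rewrite Rabs_pos_eq.
    + destruct Hy as [Hy | Hy]; [left; now apply sin_lt_x |].
      rewrite <- Hy, sin_0. lra.
    + apply sin_ge_0; generalize PI2_1; lra.
  - apply Rle_trans with 1; [apply Rabs_le, SIN_bound | lra]. }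
destruct (Rle_lt_dec 0 x) as [Hx | Hx].
- rewrite (Rabs_pos_eq x) by lra. auto.
- rewrite (Rabs_left x), <- Rabs_Ropp, <- sin_neg by lra. apply H. lra.
Qed.

Lemma Rabs_sin_add_IZR (x : R) (k : Z) :
  Rabs (sin (x + PI * IZR k)) = Rabs (sin x).
Proof.
rewrite sin_plus.
assert (H0 : sin (PI * IZR k) = 0).
{ apply sin_eq_0_1. exists k. ring. }
assert (H1 : Rabs (cos (PI * IZR k)) = 1).
{ rewrite <- Rabs_R1. apply Rsqr_eq_abs_0.
  generalize (sin2_cos2 (PI * IZR k)). rewrite H0. unfold Rsqr. lra. }
rewrite H0, Rmult_0_r, Rplus_0_r, Rabs_mult, H1. ring.
Qed.

Lemma chord_add_IZR (s t : R) (k : Z) : chord (s + IZR k) t = chord s t.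
Proof.
unfold chord. replace (PI * (s + IZR k - t)) with (PI * (s - t) + PI * IZR k) by ring.
apply Rabs_sin_add_IZR.
Qed.

Lemma chord_0 (s t : R) : chord s t = 0 -> exists k, s = t + IZR k.
Proof.
intros H. unfold chord in H.
destruct (Req_dec (sin (PI * (s - t))) 0) as [E | E].
- destruct (sin_eq_0_0 _ E) as [k Hk]. exists k.
  apply Rmult_eq_reg_l with PI; [lra | generalize PI_RGT_0; lra].
- generalize (Rabs_pos_lt _ E). lra.
Qed.

Lemma circle_dist_cover (s t : R) :
  circle_dist (cover s) (cover t) = 2 * chord s t.
Proof.
unfold circle_dist, chord, cover, Cmod; simpl.
replace (2 * Rabs (sin (PI * (s - t)))) with (Rabs (2 * sin (PI * (s - t))))
  by (rewrite Rabs_mult, (Rabs_pos_eq 2) by lra; reflexivity).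
rewrite <- sqrt_Rsqr_abs. f_equal. unfold Rsqr.
replace (2 * PI * s) with (2 * (PI * s)) by ring.
replace (2 * PI * t) with (2 * (PI * t)) by ring.
replace (PI * (s - t)) with (PI * s - PI * t) by ring.
rewrite sin_minus, !sin_2a, !cos_2a.
generalize (sin2_cos2 (PI * s)) (sin2_cos2 (PI * t)). unfold Rsqr.
set (a := sin (PI * s)). set (b := cos (PI * s)).
set (c := sin (PI * t)). set (e := cos (PI * t)). intros H1 H2.
replace (b * b) with (1 - a * a) by lra.
replace (e * e) with (1 - c * c) by lra.
transitivity (4 * (a * a) * (b * b) + 4 * (c * c) * (e * e) - 8 * a * b * c * e
  + 4 * (a * a - c * c) * (a * a - c * c)); [ring |].
transitivity (4 * (a * a) * (e * e) + 4 * (c * c) * (b * b)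
  - 8 * a * b * c * e); [| ring].
replace (b * b) with (1 - a * a) by lra.
replace (e * e) with (1 - c * c) by lra. ring.
Qed.

Lemma circle_eq (z w : circle) : proj1_sig z = proj1_sig w -> z = w.
Proof.
destruct z as [z Hz], w as [w Hw]; simpl. intros <-.
f_equal. apply proof_irrelevance.
Qed.

Lemma circle_dist_0 (z w : circle) : circle_dist z w = 0 -> z = w.
Proof.
intros H. apply circle_eq. unfold circle_dist in H. apply Cmod_eq_0 in H.
destruct (proj1_sig z) as [a b], (proj1_sig w) as [c e].
unfold Cminus, Cplus, Copp in H; simpl in H. injection H. intros H1 H2.
f_equal; lra.
Qed.

Lemma cover_eq (s t : R) : cover s = cover t -> exists k, s = t + IZR k.
Proof.
intros H. apply chord_0. generalize (circle_dist_cover s t).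
rewrite H, circle_dist_cover. unfold chord at 1.
rewrite Rminus_diag, Rmult_0_r, sin_0, Rabs_R0. lra.
Qed.

Lemma cover_add_IZR (t : R) (k : Z) : cover (t + IZR k) = cover t.
Proof.
apply circle_dist_0. rewrite circle_dist_cover, chord_add_IZR. unfold chord.
rewrite Rminus_diag, Rmult_0_r, sin_0, Rabs_R0. ring.
Qed.

Lemma cover_surj (z : circle) : exists t, cover t = z.
Proof.
destruct z as [[a b] H].
assert (Hab : a * a + b * b = 1).
{ unfold Cmod in H; simpl in H.
  rewrite <- (Rmult_1_r 1). rewrite <- H at 1 2. rewrite sqrt_sqrt; nra. }
assert (Ha : -1 <= a <= 1) by nra.
assert (Hs : sqrt (1 - Rsqr a) = Rabs b).
{ rewrite <- sqrt_Rsqr_abs. f_equal. unfold Rsqr. lra. }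
assert (HP := PI_RGT_0).
destruct (Rle_lt_dec 0 b) as [Hb | Hb].
- exists (acos a / (2 * PI)). apply circle_eq; simpl.
  replace (2 * PI * (acos a / (2 * PI))) with (acos a) by (field; lra).
  rewrite cos_acos, sin_acos, Hs, Rabs_pos_eq by lra. reflexivity.
- exists (- acos a / (2 * PI)). apply circle_eq; simpl.
  replace (2 * PI * (- acos a / (2 * PI))) with (- acos a) by (field; lra).
  rewrite cos_neg, sin_neg, cos_acos, sin_acos, Hs, Rabs_left by lra.
  f_equal. ring.
Qed.

Definition angle (z : circle) : R :=
  proj1_sig (constructive_indefinite_description _ (cover_surj z)).

Lemma cover_angle (z : circle) : cover (angle z) = z.
Proof. exact (proj2_sig (constructive_indefinite_description _ (cover_surj z))). Qed.

(** The representative [angle z] is arbitrary; for equivariant [F] the result does not depend on it,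
    by [circ_cover]. *)
Definition circ (F : R -> R) (z : circle) : circle := cover (F (angle z)).

Definition equivariant (F : R -> R) : Prop := forall t, F (t + 1) = F t + 1.

Lemma equivariant_nat (F : R -> R) : equivariant F ->
  forall t n, F (t + INR n) = F t + INR n.
Proof.
intros HF t n. induction n as [|n IH].
- simpl. now rewrite !Rplus_0_r.
- rewrite S_INR, <- Rplus_assoc, HF, IH. ring.
Qed.

Lemma equivariant_IZR (F : R -> R) : equivariant F ->
  forall t k, F (t + IZR k) = F t + IZR k.
Proof.
intros HF t k. destruct (Z_le_dec 0 k) as [Hk | Hk].
- rewrite <- (Z2Nat.id k Hk), <- INR_IZR_INZ. now apply equivariant_nat.
- assert (Hn : IZR k = - INR (Z.to_nat (- k))).
  { rewrite INR_IZR_INZ, Z2Nat.id, opp_IZR by lia. ring. }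
  rewrite Hn.
  generalize (equivariant_nat F HF (t + - INR (Z.to_nat (- k))) (Z.to_nat (- k))).
  rewrite Rplus_assoc, Rplus_opp_l, Rplus_0_r. lra.
Qed.

Lemma circ_cover (F : R -> R) : equivariant F ->
  forall t, circ F (cover t) = cover (F t).
Proof.
intros HF t. unfold circ.
destruct (cover_eq _ _ (cover_angle (cover t))) as [k Hk].
rewrite Hk, equivariant_IZR by exact HF. apply cover_add_IZR.
Qed.

Lemma circ_id (F : R -> R) : (forall t, F t = t) -> forall z, circ F z = z.
Proof. intros H z. unfold circ. rewrite H. apply cover_angle. Qed.

Lemma circ_comp (F G : R -> R) : equivariant F ->
  forall z, circ F (circ G z) = circ (fun t => F (G t)) z.
Proof. intros HF z. unfold circ at 2. now rewrite circ_cover. Qed.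

Lemma circ_inverses (F G : R -> R) : equivariant F -> equivariant G ->
  (forall t, G (F t) = t) -> (forall t, F (G t) = t) ->
  inverses (circ F) (circ G).
Proof.
intros HF HG HGF HFG. split; intros x.
- rewrite circ_comp by exact HG. now apply circ_id.
- rewrite circ_comp by exact HF. now apply circ_id.
Qed.

Lemma equivariant_comp (F G : R -> R) :
  equivariant F -> equivariant G -> equivariant (fun t => F (G t)).
Proof. intros HF HG t. now rewrite HG, HF. Qed.

(** * Moebius maps *)

(* Moebius maps of the circle are characterised by
   [|g z - g w| = |z - w| |g'(z)|^(1/2) |g'(w)|^(1/2)]. *)
Definition moebius (F : R -> R) : Prop :=
  exists dl : R -> R, (forall t, 0 < dl t) /\
    forall s t, chord (F s) (F t) = chord s t * dl s * dl t.

Lemma moebius_comp (F G : R -> R) :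
  moebius F -> moebius G -> moebius (fun t => F (G t)).
Proof.
intros [df [Hf Ef]] [dg [Hg Eg]]. exists (fun t => df (G t) * dg t). split.
- intros t. now apply Rmult_lt_0_compat.
- intros s t. rewrite Ef, Eg. ring.
Qed.

(** The angle from the unit vector (cos, sin) to its image (cos, a sin) under diag(1, a): the
    argument of [atan] is their determinant over their scalar product. For [0 < a] the scalar
    product is positive, so [atan] gives the whole angle and no branch has to be chosen. *)
Definition moebius_angle (a t : R) : R :=
  atan ((a - 1) * (sin (PI * t) * cos (PI * t))
    * / (cos (PI * t) * cos (PI * t) + a * (sin (PI * t) * sin (PI * t)))).

(* The lift of the map that multiplies the coordinate [tan (PI * t)] by [a]. *)
Definition scaling (a t : R) : R := t + moebius_angle a t * / PI.

(** The length of the vector (cos, a sin); [sqrt a / norm_scaling a t] is the square root of the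
    derivative of [scaling a]. *)
Definition norm_scaling (a t : R) : R :=
  sqrt (cos (PI * t) * cos (PI * t) + a * a * (sin (PI * t) * sin (PI * t))).

Lemma cos2_sin2_pos (a t : R) : 0 < a ->
  0 < cos (PI * t) * cos (PI * t) + a * (sin (PI * t) * sin (PI * t)).
Proof.
intros Ha. generalize (sin2_cos2 (PI * t)). unfold Rsqr.
set (s := sin (PI * t)). set (c := cos (PI * t)). intros H.
destruct (Req_dec s 0) as [E | E]; [rewrite E in *; nra |].
assert (0 < s * s) by nra. nra.
Qed.

Lemma norm_scaling_pos (a t : R) : 0 < a -> 0 < norm_scaling a t.
Proof. intros Ha. apply sqrt_lt_R0, cos2_sin2_pos. nra. Qed.

Lemma norm_scaling_sq (a t : R) : 0 < a ->
  norm_scaling a t * norm_scaling a t =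
  cos (PI * t) * cos (PI * t) + a * a * (sin (PI * t) * sin (PI * t)).
Proof. intros Ha. apply sqrt_sqrt. left. apply cos2_sin2_pos. nra. Qed.

Lemma cos_sin_moebius_angle (a t : R) : 0 < a ->
  cos (moebius_angle a t) =
    (cos (PI * t) * cos (PI * t) + a * (sin (PI * t) * sin (PI * t)))
    / norm_scaling a t /\
  sin (moebius_angle a t) =
    (a - 1) * (sin (PI * t) * cos (PI * t)) / norm_scaling a t.
Proof.
intros Ha. unfold moebius_angle. rewrite cos_atan, sin_atan.
assert (HX := cos2_sin2_pos a t Ha). assert (HN := norm_scaling_pos a t Ha).
assert (HN2 := norm_scaling_sq a t Ha). generalize (sin2_cos2 (PI * t)).
unfold Rsqr at 1 2.
set (N := norm_scaling a t) in *.
set (s := sin (PI * t)) in *. set (c := cos (PI * t)) in *. intros Hsc.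
set (X := c * c + a * (s * s)) in *. set (Y := (a - 1) * (s * c)).
assert (HXY : X * X + Y * Y = N * N).
{ rewrite HN2. unfold X, Y.
  transitivity ((c * c + a * a * (s * s)) * (s * s + c * c)); [ring |].
  rewrite Hsc. ring. }
assert (E : sqrt (1 + Rsqr (Y * / X)) = N / X).
{ replace (1 + Rsqr (Y * / X)) with (Rsqr (N / X)).
  - apply sqrt_Rsqr. left. now apply Rdiv_lt_0_compat.
  - unfold Rsqr. replace (N / X * (N / X)) with (N * N / (X * X)) by (field; lra).
    rewrite <- HXY. field. lra. }
rewrite E. split; field; lra.
Qed.

Lemma cos_sin_scaling (a t : R) : 0 < a ->
  cos (PI * scaling a t) = cos (PI * t) / norm_scaling a t /\
  sin (PI * scaling a t) = a * sin (PI * t) / norm_scaling a t.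
Proof.
intros Ha. destruct (cos_sin_moebius_angle a t Ha) as [Ec Es].
unfold scaling.
replace (PI * (t + moebius_angle a t * / PI)) with (PI * t + moebius_angle a t)
  by (field; generalize PI_RGT_0; lra).
rewrite cos_plus, sin_plus, Ec, Es.
assert (HN := norm_scaling_pos a t Ha).
generalize (sin2_cos2 (PI * t)). unfold Rsqr.
set (s := sin (PI * t)). set (c := cos (PI * t)). set (N := norm_scaling a t) in *.
intros H. split.
- transitivity (c * (s * s + c * c) / N); [field; lra | rewrite H; field; lra].
- transitivity (a * s * (s * s + c * c) / N); [field; lra | rewrite H; field; lra].
Qed.

Lemma scaling_near (a t : R) : - (1/2) < scaling a t - t < 1/2.
Proof.
unfold scaling, moebius_angle. assert (HP := PI_RGT_0).
match goal with |- context [atan ?x] => generalize (atan_bound x); set (y := atan x) end.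
intros [H1 H2].
assert (E : PI * (t + y * / PI - t) = y) by (field; lra).
split; apply Rmult_lt_reg_l with PI; lra.
Qed.

Lemma equivariant_scaling (a : R) : equivariant (scaling a).
Proof.
intros t. unfold scaling, moebius_angle.
replace (PI * (t + 1)) with (PI * t + PI) by ring.
rewrite neg_sin, neg_cos. rewrite !Rmult_opp_opp. ring.
Qed.

Lemma scaling_0 (a : R) : scaling a 0 = 0.
Proof.
unfold scaling, moebius_angle. rewrite Rmult_0_r, sin_0, Rmult_0_l, Rmult_0_r, Rmult_0_l.
rewrite atan_0. ring.
Qed.

(** The sine of a difference is the determinant of the two unit vectors, which diag(1, a) multiplies
    by [a] before the lengths are normalised. *)
Lemma sin_scaling_minus (a s t : R) : 0 < a ->
  sin (PI * (scaling a s - scaling a t)) =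
  sin (PI * (s - t)) * (sqrt a / norm_scaling a s) * (sqrt a / norm_scaling a t).
Proof.
intros Ha.
replace (PI * (scaling a s - scaling a t)) with (PI * scaling a s - PI * scaling a t) by ring.
replace (PI * (s - t)) with (PI * s - PI * t) by ring.
rewrite !sin_minus.
destruct (cos_sin_scaling a s Ha) as [-> ->].
destruct (cos_sin_scaling a t Ha) as [-> ->].
assert (H1 := norm_scaling_pos a s Ha). assert (H2 := norm_scaling_pos a t Ha).
assert (H3 : a = sqrt a * sqrt a) by (rewrite sqrt_sqrt; lra).
transitivity ((sin (PI * s) * cos (PI * t) - cos (PI * s) * sin (PI * t)) * a
  / (norm_scaling a s * norm_scaling a t)); [field; lra |].
rewrite H3 at 1. field. lra.
Qed.

Lemma moebius_scaling (a : R) : 0 < a -> moebius (scaling a).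
Proof.
intros Ha. exists (fun t => sqrt a / norm_scaling a t).
assert (Hp : forall t, 0 < sqrt a / norm_scaling a t).
{ intros t. apply Rdiv_lt_0_compat; [now apply sqrt_lt_R0 | now apply norm_scaling_pos]. }
split; [exact Hp |].
intros s t. unfold chord. rewrite sin_scaling_minus by exact Ha.
rewrite !Rabs_mult, !(Rabs_pos_eq (sqrt a / _)) by (left; apply Hp). reflexivity.
Qed.

(** For points at distance at least 1 the displacement bound 1/2 suffices; below 1 the sign of the
    sine of the difference is preserved. *)
Lemma scaling_increasing (a : R) : 0 < a ->
  forall s t, s < t -> scaling a s < scaling a t.
Proof.
intros Ha s t Hst. assert (HP := PI_RGT_0).
assert (Hs := scaling_near a s). assert (Ht := scaling_near a t).
destruct (Rle_lt_dec 1 (t - s)) as [H1 | H1]; [lra |].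
destruct (Rle_lt_dec (scaling a t) (scaling a s)) as [H | H]; [exfalso | exact H].
assert (Hpos : 0 < sin (PI * (t - s))) by (apply sin_gt_0; nra).
assert (Hneg : 0 <= sin (PI * (scaling a s - scaling a t))) by (apply sin_ge_0; nra).
rewrite sin_scaling_minus in Hneg by exact Ha.
replace (PI * (s - t)) with (- (PI * (t - s))) in Hneg by ring.
rewrite sin_neg in Hneg.
assert (H2 : 0 < sqrt a / norm_scaling a s)
  by (apply Rdiv_lt_0_compat; [now apply sqrt_lt_R0 | now apply norm_scaling_pos]).
assert (H3 : 0 < sqrt a / norm_scaling a t)
  by (apply Rdiv_lt_0_compat; [now apply sqrt_lt_R0 | now apply norm_scaling_pos]).
generalize (Rmult_lt_0_compat _ _ (Rmult_lt_0_compat _ _ Hpos H2) H3). nra.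
Qed.

(** A unit vector determines its angle modulo [2 * PI], hence [u] modulo 2. *)
Lemma direction_inj (u v : R) :
  cos (PI * u) = cos (PI * v) -> sin (PI * u) = sin (PI * v) ->
  Rabs (u - v) < 2 -> u = v.
Proof.
intros Hc Hs Hd. assert (HP := PI_RGT_0).
assert (Hsin : sin (PI * (u - v)) = 0).
{ replace (PI * (u - v)) with (PI * u - PI * v) by ring.
  rewrite sin_minus, Hc, Hs. ring. }
assert (Hcos : cos (PI * (u - v)) = 1).
{ replace (PI * (u - v)) with (PI * u - PI * v) by ring.
  rewrite cos_minus, Hc, Hs. generalize (sin2_cos2 (PI * v)). unfold Rsqr. lra. }
destruct (sin_eq_0_0 _ Hsin) as [k Hk].
assert (Hk' : u - v = IZR k) by (apply Rmult_eq_reg_l with PI; lra).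
rewrite Hk' in Hd. apply Rabs_def2 in Hd.
assert (H1 : (-2 < k)%Z) by (apply lt_IZR; simpl; lra).
assert (H2 : (k < 2)%Z) by (apply lt_IZR; simpl; lra).
rewrite Hk' in Hcos.
assert (Hcases : k = (-1)%Z \/ k = 0%Z \/ k = 1%Z) by lia.
destruct Hcases as [-> | [-> | ->]].
- replace (PI * -1) with (- PI) in Hcos by ring. rewrite cos_neg, cos_PI in Hcos. lra.
- lra.
- rewrite Rmult_1_r, cos_PI in Hcos. lra.
Qed.

Lemma norm_scaling_mult (a a' t : R) : 0 < a -> 0 < a' ->
  norm_scaling (a * a') t = norm_scaling a (scaling a' t) * norm_scaling a' t.
Proof.
intros Ha Ha'. assert (HN := norm_scaling_pos a' t Ha').
assert (HN1 := norm_scaling_pos a (scaling a' t) Ha).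
rewrite <- (sqrt_Rsqr (norm_scaling a (scaling a' t) * norm_scaling a' t))
  by (left; apply Rmult_lt_0_compat; lra).
unfold norm_scaling at 1. f_equal. unfold Rsqr.
transitivity (norm_scaling a (scaling a' t) * norm_scaling a (scaling a' t)
  * (norm_scaling a' t * norm_scaling a' t)); [| ring].
rewrite norm_scaling_sq by exact Ha.
destruct (cos_sin_scaling a' t Ha') as [-> ->]. field. lra.
Qed.

(** Both sides are directions of the same vector, and three displacement bounds 1/2 bring them
    within 3/2 of each other, where [direction_inj] applies. *)
Lemma scaling_mult (a a' t : R) : 0 < a -> 0 < a' ->
  scaling a (scaling a' t) = scaling (a * a') t.
Proof.
intros Ha Ha'. assert (Haa : 0 < a * a') by now apply Rmult_lt_0_compat.
assert (HN := norm_scaling_pos a' t Ha').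
assert (HN1 := norm_scaling_pos a (scaling a' t) Ha).
destruct (cos_sin_scaling a (scaling a' t) Ha) as [E1 E2].
destruct (cos_sin_scaling a' t Ha') as [E3 E4].
destruct (cos_sin_scaling (a * a') t Haa) as [E5 E6].
rewrite E3 in E1. rewrite E4 in E2.
rewrite norm_scaling_mult in E5, E6 by assumption.
apply direction_inj.
- rewrite E1, E5. field. lra.
- rewrite E2, E6. field. lra.
- generalize (scaling_near a (scaling a' t)) (scaling_near a' t)
    (scaling_near (a * a') t). intros. apply Rabs_def1; lra.
Qed.

Lemma scaling_1 (t : R) : scaling 1 t = t.
Proof.
unfold scaling, moebius_angle. rewrite Rminus_diag, !Rmult_0_l, atan_0. ring.
Qed.

Lemma Sm_scaling (a : R) : 0 < a -> Sm (scaling a).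
Proof.
intros Ha. unfold scaling, moebius_angle.
assert (Hs : Sm (fun t => sin (PI * t))).
{ apply (Sm_comp sin (fun t => PI * t)); [apply Sm_sin |].
  apply Sm_mult; [apply Sm_const | apply Sm_id]. }
assert (Hc : Sm (fun t => cos (PI * t))).
{ apply (Sm_comp cos (fun t => PI * t)); [apply Sm_cos |].
  apply Sm_mult; [apply Sm_const | apply Sm_id]. }
apply Sm_plus; [apply Sm_id |]. apply Sm_mult; [| apply Sm_const].
match goal with |- Sm (fun t => atan (@?q t)) => apply (Sm_comp atan q) end;
  [apply Sm_atan |].
apply Sm_mult.
- apply Sm_mult; [apply Sm_const | now apply Sm_mult].
- apply Sm_inv.
  + apply Sm_plus; apply Sm_mult; auto using Sm_const. now apply Sm_mult.
  + intros t. generalize (cos2_sin2_pos a t Ha). lra.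
Qed.

(** * Ping-pong for the two generators *)

(** The imaginary part of [cover t]. Its sign tells the half circles apart and [|height| > 3/5]
    marks the fundamental domains of f. Being 1-periodic, it lets ping-pong be played on lifts. *)
Definition height (t : R) : R := sin (2 * PI * t).

Lemma height_eq (t : R) : height t = 2 * sin (PI * t) * cos (PI * t).
Proof. unfold height. replace (2 * PI * t) with (2 * (PI * t)) by ring. apply sin_2a. Qed.

Lemma height_add_IZR (t : R) (k : Z) : height (t + IZR k) = height t.
Proof.
generalize (f_equal (fun z => snd (proj1_sig z)) (cover_add_IZR t k)). auto.
Qed.

Lemma height_add_1 (t : R) : height (t + 1) = height t.
Proof. exact (height_add_IZR t 1). Qed.

Lemma height_sub_1 (t : R) : height (t - 1) = height t.
Proof. exact (height_add_IZR t (-1)). Qed.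

Lemma height_chord (s t : R) : Rabs (height s - height t) <= 2 * chord s t.
Proof.
unfold height, chord. rewrite form4, !Rabs_mult.
replace ((2 * PI * s - 2 * PI * t) / 2) with (PI * (s - t)) by field.
rewrite (Rabs_pos_eq 2) by lra.
assert (H : Rabs (cos ((2 * PI * s + 2 * PI * t) / 2)) <= 1) by (apply Rabs_le, COS_bound).
generalize (Rabs_pos (sin (PI * (s - t)))). nra.
Qed.

(* In the coordinate [x = tan (PI * t)] this says [1/3 < |x| < 3]. *)
Lemma height_large (t : R) :
  3/5 < Rabs (height t) <->
  cos (PI * t) * cos (PI * t) < 9 * (sin (PI * t) * sin (PI * t)) /\
  sin (PI * t) * sin (PI * t) < 9 * (cos (PI * t) * cos (PI * t)).
Proof.
assert (E : 3/5 < Rabs (height t) <-> 9/25 < height t * height t).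
{ replace (9/25) with ((3/5) * (3/5)) by field.
  replace (height t * height t) with (Rabs (height t) * Rabs (height t)).
  - generalize (Rabs_pos (height t)). intros. split; intros; nra.
  - rewrite <- Rabs_mult. apply Rabs_pos_eq. nra. }
rewrite E, height_eq. generalize (sin2_cos2 (PI * t)). unfold Rsqr.
set (s := sin (PI * t)). set (c := cos (PI * t)). intros H.
replace (2 * s * c * (2 * s * c)) with (4 * ((s * s) * (c * c))) by ring.
replace (c * c) with (1 - s * s) by lra. set (u := s * s).
split; intros; nra.
Qed.

Lemma height_scaling (a t : R) : 0 < a ->
  height (scaling a t) = a * height t / (norm_scaling a t * norm_scaling a t).
Proof.
intros Ha. rewrite !height_eq. destruct (cos_sin_scaling a t Ha) as [-> ->].
assert (HN := norm_scaling_pos a t Ha). field. lra.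
Qed.

Lemma height_scaling_pos (a t : R) : 0 < a -> 0 < height t -> 0 < height (scaling a t).
Proof.
intros Ha H. rewrite height_scaling by exact Ha.
assert (HN := norm_scaling_pos a t Ha).
apply Rdiv_lt_0_compat; now apply Rmult_lt_0_compat.
Qed.

Lemma height_scaling_neg (a t : R) : 0 < a -> height t < 0 -> height (scaling a t) < 0.
Proof.
intros Ha H. rewrite height_scaling by exact Ha.
assert (HN := norm_scaling_pos a t Ha).
apply Ropp_lt_cancel. rewrite Ropp_0.
replace (- (a * height t / (norm_scaling a t * norm_scaling a t)))
  with (a * (- height t) / (norm_scaling a t * norm_scaling a t)) by (field; lra).
apply Rdiv_lt_0_compat; apply Rmult_lt_0_compat; lra.
Qed.

(** From [1/3 < |x|] follows [3 < |a x|]; 9 is the ratio of the ends 3 and 1/3. *)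
Lemma height_large_scaling (a t : R) : 9 <= a ->
  3/5 < Rabs (height t) -> ~ 3/5 < Rabs (height (scaling a t)).
Proof.
intros Ha H1 H2. apply height_large in H1, H2.
assert (Ha0 : 0 < a) by lra.
destruct (cos_sin_scaling a t Ha0) as [E1 E2]. rewrite E1, E2 in H2.
destruct H1 as [H1 _], H2 as [_ H2].
assert (HN := norm_scaling_pos a t Ha0).
set (N := norm_scaling a t) in *. set (s := sin (PI * t)) in *.
set (c := cos (PI * t)) in *.
apply (Rmult_lt_compat_r (N * N)) in H2; [| nra].
replace (a * s / N * (a * s / N) * (N * N)) with (a * a * (s * s)) in H2 by (field; lra).
replace (9 * (c / N * (c / N)) * (N * N)) with (9 * (c * c)) in H2 by (field; lra).
assert (81 * (s * s) <= a * a * (s * s)) by (apply Rmult_le_compat_r; nra). lra.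
Qed.

Definition Fpow (n : Z) : R -> R := scaling (powerRZ 9 n).

Lemma pow9_pos (n : Z) : 0 < powerRZ 9 n.
Proof. apply powerRZ_lt. lra. Qed.

#[local] Hint Resolve pow9_pos : core.

Lemma Fpow_add (m n : Z) (t : R) : Fpow m (Fpow n t) = Fpow (m + n) t.
Proof. unfold Fpow. rewrite scaling_mult, powerRZ_add by (auto; lra). reflexivity. Qed.

Lemma Fpow_0 (t : R) : Fpow 0 t = t.
Proof. apply scaling_1. Qed.

Lemma Fpow_opp (n : Z) (t : R) : Fpow (- n) (Fpow n t) = t.
Proof. rewrite Fpow_add, Z.add_opp_diag_l. apply Fpow_0. Qed.

Lemma Fpow_opp_r (n : Z) (t : R) : Fpow n (Fpow (- n) t) = t.
Proof. rewrite Fpow_add, Z.add_opp_diag_r. apply Fpow_0. Qed.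

Lemma pow9_ge (n : Z) : (0 < n)%Z -> 9 <= powerRZ 9 n.
Proof.
intros Hn. replace n with (1 + (n - 1))%Z by ring.
rewrite powerRZ_add by lra. rewrite powerRZ_1.
replace (n - 1)%Z with (Z.of_nat (Z.to_nat (n - 1))) by lia.
rewrite <- pow_powerRZ.
generalize (pow_R1_Rle 9 (Z.to_nat (n - 1)) ltac:(lra)). lra.
Qed.

Lemma height_large_Fpow (n : Z) (t : R) :
  3/5 < Rabs (height t) -> 3/5 < Rabs (height (Fpow n t)) -> n = 0%Z.
Proof.
intros H1 H2. destruct (Z.lt_trichotomy n 0) as [Hn | [Hn | Hn]]; [exfalso | exact Hn | exfalso].
- apply (height_large_scaling (powerRZ 9 (- n)) (Fpow n t)); [| exact H2 |].
  + apply pow9_ge. lia.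
  + fold (Fpow (- n)). now rewrite Fpow_opp.
- apply (height_large_scaling (powerRZ 9 n) t); [| exact H1 | exact H2].
  now apply pow9_ge.
Qed.

(** Translation by 1/2 is [x -> - 1 / x], which conjugates [x -> a x] to [x -> x / a]. *)
Lemma scaling_half (a t : R) : 0 < a -> scaling a (t + 1/2) = scaling (/ a) t + 1/2.
Proof.
intros Ha. unfold scaling, moebius_angle.
assert (HX := cos2_sin2_pos (/ a) t ltac:(now apply Rinv_0_lt_compat)).
replace (PI * (t + 1/2)) with (PI / 2 + PI * t) by field.
rewrite sin_plus, cos_plus, sin_PI2, cos_PI2.
set (s := sin (PI * t)) in *. set (c := cos (PI * t)) in *.
match goal with |- t + 1/2 + atan ?x * _ = t + atan ?y * _ + _ =>
  replace x with y; [ring |] end.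
field. assert (a * (c * c + / a * (s * s)) = a * (c * c) + s * s) by (field; lra).
assert (0 < a * (c * c + / a * (s * s))) by (apply Rmult_lt_0_compat; lra).
repeat split; nra.
Qed.

(* In the coordinate [y = tan (PI * (t - 1/4))] this is the map [y -> - 16 / y]. *)
Definition Sl (t : R) : R := scaling 16 (t + 1/4) + 1/4.
(** [Sl] squares to translation by 1, a lift of the identity. So [Sl] and [Sli] induce the same
    involution of the circle, but on the line it is [Sli] that inverts [Sl]. *)
Definition Sli (t : R) : R := Sl t - 1.

Lemma equivariant_Sl : equivariant Sl.
Proof.
intros t. unfold Sl. replace (t + 1 + 1/4) with (t + 1/4 + 1) by ring.
rewrite equivariant_scaling. ring.
Qed.

Lemma equivariant_Sli : equivariant Sli.
Proof. intros t. unfold Sli. rewrite equivariant_Sl. ring. Qed.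

Lemma Sl_Sl (t : R) : Sl (Sl t) = t + 1.
Proof.
unfold Sl at 1. unfold Sl.
replace (scaling 16 (t + 1/4) + 1/4 + 1/4) with (scaling 16 (t + 1/4) + 1/2) by field.
rewrite scaling_half, scaling_mult, Rinv_l, scaling_1 by lra. field.
Qed.

Lemma Sl_Sli (t : R) : Sl (Sli t) = t.
Proof.
unfold Sli. generalize (equivariant_Sl (Sl t - 1)).
replace (Sl t - 1 + 1) with (Sl t) by ring. rewrite Sl_Sl. lra.
Qed.

Lemma Sli_Sl (t : R) : Sli (Sl t) = t.
Proof. unfold Sli. rewrite Sl_Sl. ring. Qed.

Lemma moebius_Sl : moebius Sl.
Proof.
destruct (moebius_scaling 16 ltac:(lra)) as [dl [Hd E]].
exists (fun t => dl (t + 1/4)). split; [auto |].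
intros s t. transitivity (chord (scaling 16 (s + 1/4)) (scaling 16 (t + 1/4))).
- unfold chord, Sl. do 3 f_equal. ring.
- rewrite E. unfold chord. do 4 f_equal. f_equal. ring.
Qed.

Lemma Sl_increasing (s t : R) : s < t -> Sl s < Sl t.
Proof.
intros H. unfold Sl.
assert (scaling 16 (s + 1/4) < scaling 16 (t + 1/4)) by (apply scaling_increasing; lra).
lra.
Qed.

Lemma Sm_Sl : Sm Sl.
Proof.
unfold Sl. apply Sm_plus; [| apply Sm_const].
apply (Sm_comp (scaling 16) (fun t => t + 1/4)); [apply Sm_scaling; lra |].
apply Sm_plus; [apply Sm_id | apply Sm_const].
Qed.

Lemma height_quarter (t : R) :
  height (t + 1/4) = cos (PI * t) * cos (PI * t) - sin (PI * t) * sin (PI * t).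
Proof.
unfold height. replace (2 * PI * (t + 1/4)) with (PI / 2 + 2 * (PI * t)) by field.
now rewrite sin_plus, sin_PI2, cos_PI2, cos_2a, Rmult_0_l, Rplus_0_r, Rmult_1_l.
Qed.

Lemma height_bound (t : R) : -1 <= height t <= 1.
Proof. apply SIN_bound. Qed.

(** In the coordinate [y = tan (PI * (t - 1/4))] the height is [(1 - y^2) / (1 + y^2)], and [y^2]
    becomes [256 / y^2]; 255 and 257 are [256 - 1] and [256 + 1]. *)
Lemma height_Sl (t : R) :
  height (Sl t) * (257 + 255 * height t) = - (255 + 257 * height t).
Proof.
unfold Sl. rewrite height_quarter.
destruct (cos_sin_scaling 16 (t + 1/4) ltac:(lra)) as [-> ->].
assert (HN := norm_scaling_pos 16 (t + 1/4) ltac:(lra)).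
assert (HN2 := norm_scaling_sq 16 (t + 1/4) ltac:(lra)).
assert (Ht : height t = 2 * (sin (PI * (t + 1/4)) * sin (PI * (t + 1/4))) - 1).
{ generalize (height_quarter (t + 1/4)).
  replace (t + 1/4 + 1/4) with (t + 1/2) by field.
  unfold height. replace (2 * PI * (t + 1/2)) with (2 * PI * t + PI) by field.
  rewrite neg_sin. generalize (sin2_cos2 (PI * (t + 1/4))). unfold Rsqr. lra. }
generalize (sin2_cos2 (PI * (t + 1/4))). unfold Rsqr.
set (N := norm_scaling 16 (t + 1/4)) in *. set (s := sin (PI * (t + 1/4))) in *.
set (c := cos (PI * (t + 1/4))) in *. intros Hsc.
assert (HH : 257 + 255 * height t = 2 * (N * N)).
{ rewrite Ht, HN2. replace (c * c) with (1 - s * s) by lra. ring. }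
rewrite HH. replace ((c / N * (c / N) - 16 * s / N * (16 * s / N)) * (2 * (N * N)))
  with (2 * (c * c) - 512 * (s * s)) by (field; lra).
rewrite Ht. replace (c * c) with (1 - s * s) by lra. ring.
Qed.

(** By [height_Sl] the new height decreases with the old one, and -3/5 goes to -63/65. *)
Lemma Sl_contracts (t : R) : - (3/5) <= height t -> height (Sl t) <= - (63/65).
Proof. intros H. generalize (height_Sl t). generalize (height_bound t). nra. Qed.

Lemma Sli_contracts (t : R) : - (3/5) <= height t -> height (Sli t) <= - (63/65).
Proof. unfold Sli. rewrite height_sub_1. apply Sl_contracts. Qed.

(** This is the level [y^2 = 16], whose two points are exchanged by [y -> - 16 / y]. *)
Lemma Sli_height_fixed (t : R) : height t = - (15/17) -> height (Sli t) = - (15/17).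
Proof.
unfold Sli. rewrite height_sub_1. intros H. generalize (height_Sl t). rewrite H. lra.
Qed.

Lemma height_fixed_exists : exists c, height c = - (15/17).
Proof.
exists (asin (- (15/17)) / (2 * PI)). unfold height.
replace (2 * PI * (asin (- (15/17)) / (2 * PI))) with (asin (- (15/17)))
  by (field; generalize PI_RGT_0; lra).
apply sin_asin. lra.
Qed.

(* [Power n] is f^(n+1) and [Step m w] is f^m s w.  These are the reduced words
   ending in a positive power of f, other than those beginning with s. *)
Inductive word : Type :=
| Power (n : nat)
| Step (m : Z) (w : word).

Fixpoint reduced (w : word) : Prop :=
  match w with Power _ => True | Step m w => m <> 0%Z /\ reduced w end.

Fixpoint ev (w : word) (t : R) : R :=
  match w with
  | Power n => Fpow (Z.of_nat (S n)) t
  | Step m w => Fpow m (Sl (ev w t))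
  end.

Fixpoint evi (w : word) (t : R) : R :=
  match w with
  | Power n => Fpow (- Z.of_nat (S n)) t
  | Step m w => evi w (Sli (Fpow (- m) t))
  end.

Lemma ev_evi (w : word) : forall t, ev w (evi w t) = t.
Proof.
induction w as [n | m w IH]; intros t; cbn [ev evi].
- apply Fpow_opp_r.
- now rewrite IH, Sl_Sli, Fpow_opp_r.
Qed.

Lemma evi_ev (w : word) : forall t, evi w (ev w t) = t.
Proof.
induction w as [n | m w IH]; intros t; cbn [ev evi].
- apply Fpow_opp.
- now rewrite Fpow_opp, Sli_Sl, IH.
Qed.

Lemma equivariant_ev (w : word) : equivariant (ev w).
Proof.
induction w as [n | m w IH]; intros t; cbn [ev].
- apply equivariant_scaling.
- rewrite IH, equivariant_Sl. apply equivariant_scaling.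
Qed.

Lemma equivariant_evi (w : word) : equivariant (evi w).
Proof.
induction w as [n | m w IH]; intros t; cbn [evi].
- apply equivariant_scaling.
- unfold Fpow. rewrite equivariant_scaling, equivariant_Sli. apply IH.
Qed.

Lemma ev_increasing (w : word) : forall s t, s < t -> ev w s < ev w t.
Proof.
induction w as [n | m w IH]; intros s t H; cbn [ev]; apply scaling_increasing; auto.
now apply Sl_increasing, IH.
Qed.

Lemma moebius_ev (w : word) : moebius (ev w).
Proof.
induction w as [n | m w IH]; cbn [ev].
- apply moebius_scaling; auto.
- apply (moebius_comp (Fpow m) (fun t => Sl (ev w t))).
  + apply moebius_scaling; auto.
  + apply (moebius_comp Sl (ev w)); [exact moebius_Sl | exact IH].
Qed.

Lemma Rabs_neg_large (x : R) : x < - (3/5) -> 3/5 < Rabs x.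
Proof. intros H. rewrite Rabs_left; lra. Qed.

Lemma Rabs_pos_large (x : R) : 3/5 < x -> 3/5 < Rabs x.
Proof. intros H. rewrite Rabs_pos_eq; lra. Qed.

(** Ping-pong: s sends heights at least -3/5 into the lower fundamental domain, and a nonzero power
    of f moves this domain off itself. The positive power of f that acts first keeps the point in
    the upper half circle. *)
Lemma height_ev (w : word) : reduced w -> forall u, 3/5 <= height u ->
  - (3/5) <= height (ev w u).
Proof.
induction w as [n | m w IH]; intros Hw u Hu; cbn [ev].
- generalize (height_scaling_pos _ u (pow9_pos (Z.of_nat (S n)))). unfold Fpow. lra.
- destruct Hw as [Hm Hw]. specialize (IH Hw u Hu). apply Sl_contracts in IH.
  apply Rnot_lt_le. intros H. apply Hm.
  apply (height_large_Fpow m (Sl (ev w u))); apply Rabs_neg_large; lra.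
Qed.

(** The same game for the inverse word: a nonzero power of f takes [c] out of the lower fundamental
    domain, s brings it back, and the final power of f preserves the lower half circle. *)
Lemma height_evi (w : word) : reduced w -> forall c, height c < - (3/5) ->
  height (evi w c) < 0.
Proof.
induction w as [n | m w IH]; intros Hw c Hc; cbn [evi].
- apply height_scaling_neg; auto. lra.
- destruct Hw as [Hm Hw]. apply (IH Hw).
  apply Rle_lt_trans with (- (63/65)); [| lra]. apply Sli_contracts.
  apply Rnot_lt_le. intros H. apply Hm.
  assert (E : (- m)%Z = 0%Z) by
    (apply (height_large_Fpow _ c); apply Rabs_neg_large; lra).
  lia.
Qed.

(** The word is read off from [t]. The sign of its height separates [Power] from [Step]; the
    exponent of f is the only one that brings [t] back to the fundamental domain of its half circle;
    the tail follows by induction. *)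
Lemma evi_unique (w1 : word) : reduced w1 -> forall w2 t, reduced w2 ->
  3/5 < height (evi w1 t) -> 3/5 < height (evi w2 t) -> w1 = w2.
Proof.
assert (HB : forall n t, 3/5 < height (Fpow (- n) t) -> 0 < height t).
{ intros n t H. rewrite <- (Fpow_opp_r n t). apply height_scaling_pos; auto. lra. }
assert (HS : forall m w t, reduced w -> 3/5 < height (evi w (Sli (Fpow (- m) t))) ->
  height (Fpow (- m) t) < - (3/5)).
{ intros m w t Hw H. set (x := Fpow (- m) t) in *.
  assert (H1 := height_ev w Hw (evi w (Sli x)) ltac:(lra)). rewrite ev_evi in H1.
  apply Sl_contracts in H1. rewrite Sl_Sli in H1. lra. }
assert (HSB : forall m t, height (Fpow (- m) t) < - (3/5) -> height t < 0).
{ intros m t H. rewrite <- (Fpow_opp_r m t). apply height_scaling_neg; auto. lra. }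
induction w1 as [n1 | m1 w1 IH]; intros Hw1 [n2 | m2 w2] t Hw2 H1 H2;
  cbn [evi] in H1, H2.
- f_equal.
  assert (E : (- Z.of_nat (S n1) + Z.of_nat (S n2))%Z = 0%Z).
  { apply (height_large_Fpow _ (Fpow (- Z.of_nat (S n2)) t)).
    - now apply Rabs_pos_large.
    - rewrite Fpow_add. apply Rabs_pos_large.
      replace (- Z.of_nat (S n1) + Z.of_nat (S n2) + - Z.of_nat (S n2))%Z
        with (- Z.of_nat (S n1))%Z by ring. exact H1. }
  lia.
- destruct Hw2 as [_ Hw2]. apply HB in H1. apply HS in H2; [| exact Hw2].
  apply HSB in H2. lra.
- destruct Hw1 as [_ Hw1]. apply HB in H2. apply HS in H1; [| exact Hw1].
  apply HSB in H1. lra.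
- destruct Hw1 as [Hm1 Hw1], Hw2 as [Hm2 Hw2].
  assert (E : (- m1 + m2)%Z = 0%Z).
  { apply (height_large_Fpow _ (Fpow (- m2) t)).
    - apply Rabs_neg_large. now apply (HS _ w2).
    - rewrite Fpow_add. replace (- m1 + m2 + - m2)%Z with (- m1)%Z by ring.
      apply Rabs_neg_large. now apply (HS _ w1). }
  assert (E' : m1 = m2) by lia. subst m2. f_equal.
  now apply (IH Hw1 w2 (Sli (Fpow (- m1) t))).
Qed.

(** The boolean tells whether the group word begins with an additional s. A gap stands for the arc
    g(D), and [in_gap g] for all lifts of this arc to the line. *)
Definition gap : Type := (bool * word)%type.

Definition evg (g : gap) (t : R) : R := if fst g then Sl (ev (snd g) t) else ev (snd g) t.
Definition evgi (g : gap) (t : R) : R :=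
  if fst g then evi (snd g) (Sli t) else evi (snd g) t.

Definition in_gap (g : gap) (t : R) : Prop :=
  reduced (snd g) /\ 3/5 < height (evgi g t).

Lemma evg_evgi (g : gap) (t : R) : evg g (evgi g t) = t.
Proof.
destruct g as [[|] w]; unfold evg, evgi; simpl.
- now rewrite ev_evi, Sl_Sli.
- apply ev_evi.
Qed.

Lemma evgi_evg (g : gap) (t : R) : evgi g (evg g t) = t.
Proof.
destruct g as [[|] w]; unfold evg, evgi; simpl.
- now rewrite Sli_Sl, evi_ev.
- apply evi_ev.
Qed.

Lemma equivariant_evg (g : gap) : equivariant (evg g).
Proof.
destruct g as [[|] w]; intros t; unfold evg; simpl.
- now rewrite equivariant_ev, equivariant_Sl.
- apply equivariant_ev.
Qed.

Lemma equivariant_evgi (g : gap) : equivariant (evgi g).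
Proof.
destruct g as [[|] w]; intros t; unfold evgi; simpl.
- now rewrite equivariant_Sli, equivariant_evi.
- apply equivariant_evi.
Qed.

Lemma evg_increasing (g : gap) (s t : R) : s < t -> evg g s < evg g t.
Proof.
destruct g as [[|] w]; intros H; unfold evg; simpl.
- now apply Sl_increasing, ev_increasing.
- now apply ev_increasing.
Qed.

Lemma evgi_increasing (g : gap) (s t : R) : s < t -> evgi g s < evgi g t.
Proof.
apply (increasing_recip (evg g) (evgi g)).
- apply evg_increasing.
- apply evg_evgi.
Qed.

(** A leading s is visible in the height of [t]: at most -63/65 with it, at least -3/5 without
    it. *)
Lemma in_gap_unique (g1 g2 : gap) (t : R) : in_gap g1 t -> in_gap g2 t -> g1 = g2.
Proof.
destruct g1 as [[|] w1], g2 as [[|] w2]; unfold in_gap, evgi; simpl;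
  intros [Hw1 H1] [Hw2 H2].
- f_equal. now apply (evi_unique w1 Hw1 w2 (Sli t)).
- assert (H3 := height_ev w1 Hw1 (evi w1 (Sli t)) ltac:(lra)). rewrite ev_evi in H3.
  assert (H4 := height_ev w2 Hw2 (evi w2 t) ltac:(lra)). rewrite ev_evi in H4.
  apply Sl_contracts in H3. rewrite Sl_Sli in H3. lra.
- assert (H3 := height_ev w2 Hw2 (evi w2 (Sli t)) ltac:(lra)). rewrite ev_evi in H3.
  assert (H4 := height_ev w1 Hw1 (evi w1 t) ltac:(lra)). rewrite ev_evi in H4.
  apply Sl_contracts in H3. rewrite Sl_Sli in H3. lra.
- f_equal. now apply (evi_unique w1 Hw1 w2 t).
Qed.

(* The point [c] of height -15/17 lies between the ping-pong domains, so its
   preimage under [evg g] stays away from the arc [3/5 <= height], and a Moebius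
   map has bounded distortion away from the preimage of a point far from its image. *)
Lemma gap_distortion (g : gap) : reduced (snd g) ->
  exists dl : R -> R, (forall t, 0 < dl t) /\
    (forall s t, chord (evg g s) (evg g t) = chord s t * dl s * dl t) /\
    forall u v, 3/5 <= height u -> 3/5 <= height v -> dl u <= 100 * dl v.
Proof.
intros Hg. destruct height_fixed_exists as [c Hc].
assert (Hm : moebius (evg g)).
{ destruct g as [[|] w]; unfold evg; simpl.
  - apply (moebius_comp Sl (ev w)); [apply moebius_Sl | apply moebius_ev].
  - apply moebius_ev. }
destruct Hm as [dl [Hd E]]. exists dl. split; [exact Hd |]. split; [exact E |].
intros u v Hu Hv.
assert (Hc1 : height (evgi g c) < 0).
{ destruct g as [[|] w]; unfold evgi; simpl; apply (height_evi w Hg).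
  - rewrite Sli_height_fixed by exact Hc. lra.
  - lra. }
(* A chord is at least half the difference of the heights, here at least
   [(63/65 - 15/17) / 2 > 1/25]. With the bound 3/10 below, [dl u * e <= 10/3] and
   [1/25 <= dl v * e], so the ratio is at most 250/3, rounded up to 100. *)
assert (Hfar : 1/25 <= chord (evg g v) c).
{ assert (H1 := height_chord (evg g v) c). rewrite Hc in H1.
  destruct g as [[|] w]; unfold evg in *; simpl in *;
    assert (H2 := height_ev w Hg v Hv).
  - apply Sl_contracts in H2. rewrite Rabs_left in H1 by lra. lra.
  - rewrite Rabs_pos_eq in H1 by lra. lra. }
assert (Hu1 : 3/10 <= chord u (evgi g c)).
{ assert (H1 := height_chord u (evgi g c)). rewrite Rabs_pos_eq in H1 by lra. lra. }
assert (Ev := E v (evgi g c)). assert (Eu := E u (evgi g c)).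
rewrite evg_evgi in Ev, Eu.
assert (Hu2 := chord_le_1 (evg g u) c). assert (Hv2 := chord_le_1 v (evgi g c)).
rewrite Ev in Hfar. rewrite Eu in Hu2.
assert (Pu := Hd u). assert (Pv := Hd v). assert (Pc := Hd (evgi g c)).
set (e := dl (evgi g c)) in *.
assert (H1 : 3/10 * (dl u * e) <= 1).
{ apply Rle_trans with (2 := Hu2). rewrite Rmult_assoc.
  apply Rmult_le_compat_r; [| exact Hu1]. left. now apply Rmult_lt_0_compat. }
assert (H2 : 1/25 <= dl v * e).
{ apply Rle_trans with (1 := Hfar). rewrite Rmult_assoc.
  rewrite <- (Rmult_1_l (dl v * e)) at 2.
  apply Rmult_le_compat_r; [| exact Hv2]. left. now apply Rmult_lt_0_compat. }
apply Rmult_le_reg_r with e; [exact Pc |]. lra.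
Qed.

(** * The deformation *)

Lemma integer_translate (t a : R) : exists k : Z, a <= t + IZR k < a + 1.
Proof.
exists (- (up (t - a) - 1))%Z. rewrite opp_IZR, minus_IZR. simpl.
generalize (archimed (t - a)). lra.
Qed.

Lemma height_component (t : R) : 3/5 < height t ->
  exists al be, al < t < be /\ height al = 3/5 /\ height be = 3/5 /\
    forall u, al < u < be -> 3/5 < height u.
Proof.
intros Ht. assert (HP := PI_RGT_0).
set (th := asin (3/5) / (2 * PI)).
assert (Hth : 2 * PI * th = asin (3/5)) by (unfold th; field; lra).
assert (Hs : sin (2 * PI * th) = 3/5) by (rewrite Hth; apply sin_asin; lra).
assert (Hb : 0 < th < 1/4).
{ assert (Hlt := asin_bound_lt (3/5) ltac:(lra)). rewrite <- Hth in Hlt.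
  assert (Hth1 : th < 1/4) by (apply Rmult_lt_reg_l with (2 * PI); lra).
  split; [| exact Hth1]. apply Rnot_le_lt. intros Hneg.
  assert (Hsin : sin (- (2 * PI * th)) >= 0).
  { apply Rle_ge, sin_ge_0; nra. }
  rewrite sin_neg, Hs in Hsin. lra. }
assert (Hmain : forall u, 0 <= u < 1 -> (3/5 < height u <-> th < u < 1/2 - th)).
{ assert (Hq : forall u, 0 <= u <= 1/4 -> (3/5 < height u <-> th < u)).
  { intros u Hu. unfold height. split; intros H.
    - apply Rnot_le_lt. intros Hle. destruct Hle as [Hle | Hle].
      + assert (sin (2 * PI * u) < sin (2 * PI * th)) by (apply sin_increasing_1; nra).
        lra.
      + rewrite Hle in H. lra.
    - rewrite <- Hs. apply sin_increasing_1; nra. }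
  intros u Hu. destruct (Rle_lt_dec u (1/4)) as [H1 | H1].
  - rewrite Hq by lra. split; lra.
  - destruct (Rle_lt_dec u (1/2)) as [H2 | H2].
    + replace (height u) with (height (1/2 - u)).
      * rewrite Hq by lra. split; lra.
      * unfold height. rewrite <- sin_PI_x. f_equal. field.
    + split; [| lra]. intros H. exfalso. unfold height in H.
      assert (sin (2 * PI * u) <= 0) by (apply sin_le_0; nra). lra. }
destruct (integer_translate t 0) as [k Hk]. rewrite Rplus_0_l in Hk.
assert (Ht' : 3/5 < height (t + IZR k)) by now rewrite height_add_IZR.
apply Hmain in Ht'; [| exact Hk].
exists (th + IZR (- k)), (1/2 - th + IZR (- k)).
rewrite !height_add_IZR, opp_IZR. split; [lra |]. split; [exact Hs |]. split.
- unfold height. rewrite <- Hs, <- sin_PI_x. f_equal. field.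
- intros u Hu. rewrite <- (height_add_IZR u k). apply Hmain; lra.
Qed.

(** Both k and its inverse are instances, so each estimate on [spread] is proved once and used for
    the conjugacy and for its inverse. *)
Definition deformation (K : R -> R) : Prop :=
  equivariant K /\ (forall s t, s < t -> K s < K t) /\
  (forall t, height t <= 3/5 -> K t = t) /\
  (forall s t, chord (K s) (K t) <= 2 * chord s t).

Lemma deformation_height (K : R -> R) : deformation K ->
  forall t, 3/5 < height t -> 3/5 < height (K t).
Proof.
intros [_ [Hi [Hf _]]] t Ht.
destruct (height_component t Ht) as [al [be [H [Ha [Hb HD]]]]].
apply HD. rewrite <- (Hf al) by lra. rewrite <- (Hf be) by lra.
split; apply Hi; lra.
Qed.

Lemma deformation_height_le (K : R -> R) : deformation K ->
  forall t, 3/5 <= height t -> 3/5 <= height (K t).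
Proof.
intros HK t [Ht | Ht].
- left. now apply deformation_height.
- destruct HK as [_ [_ [Hf _]]]. rewrite Hf; lra.
Qed.

(** For [K] the lift of k this is the lift of phi. The gap is picked by a choice operator, but there
    is only one to pick, by [in_gap_unique]. *)
Definition spread (K : R -> R) (t : R) : R :=
  match excluded_middle_informative (exists g, in_gap g t) with
  | left H => let g := proj1_sig (constructive_indefinite_description _ H) in
      evg g (K (evgi g t))
  | right _ => t
  end.

Lemma spread_in (K : R -> R) (g : gap) (t : R) :
  in_gap g t -> spread K t = evg g (K (evgi g t)).
Proof.
intros Hg. unfold spread. destruct (excluded_middle_informative _) as [H | H].
- destruct (constructive_indefinite_description _ H) as [g' Hg']. simpl.
  now rewrite (in_gap_unique g' g t Hg' Hg).
- exfalso. eauto.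
Qed.

Lemma spread_out (K : R -> R) (t : R) :
  (forall g, ~ in_gap g t) -> spread K t = t.
Proof.
intros Hg. unfold spread. destruct (excluded_middle_informative _) as [[g H] | H].
- exfalso. now apply (Hg g).
- reflexivity.
Qed.

Lemma in_gap_dec (t : R) : (exists g, in_gap g t) \/ (forall g, ~ in_gap g t).
Proof.
destruct (classic (exists g, in_gap g t)) as [H | H]; [now left | right].
intros g Hg. apply H. now exists g.
Qed.

Lemma in_gap_add_IZR (g : gap) (t : R) (k : Z) : in_gap g (t + IZR k) <-> in_gap g t.
Proof.
unfold in_gap. rewrite (equivariant_IZR _ (equivariant_evgi g)), height_add_IZR.
reflexivity.
Qed.

Lemma equivariant_spread (K : R -> R) : equivariant K -> equivariant (spread K).
Proof.
intros HK t. destruct (in_gap_dec t) as [[g Hg] | Hg].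
- rewrite (spread_in K g t Hg), (spread_in K g).
  + now rewrite equivariant_evgi, HK, equivariant_evg.
  + now apply (in_gap_add_IZR g t 1).
- rewrite !spread_out; auto.
  intros g H. apply (Hg g). now apply (in_gap_add_IZR g t 1).
Qed.

Lemma in_gap_spread (K : R -> R) (g : gap) (t : R) : deformation K ->
  in_gap g t -> in_gap g (spread K t).
Proof.
intros HK Hg. rewrite (spread_in K g t Hg). destruct Hg as [Hw H].
split; [exact Hw |]. rewrite evgi_evg. now apply deformation_height.
Qed.

Lemma spread_inverse (K K' : R -> R) : deformation K -> deformation K' ->
  (forall t, K (K' t) = t) -> forall t, spread K (spread K' t) = t.
Proof.
intros HK HK' H t. destruct (in_gap_dec t) as [[g Hg] | Hg].
- rewrite (spread_in K g); [| now apply in_gap_spread].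
  rewrite (spread_in K' g t Hg), evgi_evg, H. apply evg_evgi.
- rewrite (spread_out K' t Hg). now apply spread_out.
Qed.

(* The endpoints are written [evg g al] and [evg g be] because deformations fix
   [al] and [be]. *)
Lemma gap_component (g : gap) (t : R) : in_gap g t ->
  exists al be, height al = 3/5 /\ height be = 3/5 /\
    evg g al < t < evg g be /\
    forall u, evg g al < u < evg g be -> in_gap g u.
Proof.
intros [Hw Ht]. destruct (height_component _ Ht) as [al [be [H [Ha [Hb HD]]]]].
exists al, be. split; [exact Ha |]. split; [exact Hb |]. split.
- rewrite <- (evg_evgi g t). split; apply evg_increasing; lra.
- intros u Hu. split; [exact Hw |]. apply HD.
  rewrite <- (evgi_evg g al), <- (evgi_evg g be).
  split; apply evgi_increasing; lra.
Qed.

Lemma spread_increasing (K : R -> R) : deformation K ->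
  forall s t, s < t -> spread K s < spread K t.
Proof.
intros HK. destruct (HK) as [_ [Hi [Hf _]]].
assert (Hsame : forall g s t, s < t -> evg g (K (evgi g s)) < evg g (K (evgi g t))).
{ intros g s t H. now apply evg_increasing, Hi, evgi_increasing. }
assert (Hlow : forall g t al, in_gap g t -> height al = 3/5 -> evg g al < t ->
  evg g al < spread K t).
{ intros g t al Hg Hal H. rewrite (spread_in K g t Hg).
  apply (Hsame g) in H. rewrite evgi_evg, (Hf al) in H by lra. exact H. }
assert (Hup : forall g t be, in_gap g t -> height be = 3/5 -> t < evg g be ->
  spread K t < evg g be).
{ intros g t be Hg Hbe H. rewrite (spread_in K g t Hg).
  apply (Hsame g) in H. rewrite evgi_evg, (Hf be) in H by lra. exact H. }
intros s t Hst.
destruct (in_gap_dec s) as [[g Hg] | Hg]; destruct (in_gap_dec t) as [[h Hh] | Hh].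
- destruct (gap_component g s Hg) as [al [be [Ha [Hb [Hs HI]]]]].
  destruct (gap_component h t Hh) as [al' [be' [Ha' [Hb' [Ht HI']]]]].
  destruct (Rlt_le_dec t (evg g be)) as [H1 | H1].
  + assert (Hgt : in_gap g t) by (apply HI; lra).
    rewrite (spread_in K g s Hg), (spread_in K g t Hgt). now apply Hsame.
  + destruct (Rle_lt_dec (evg g be) (evg h al')) as [H2 | H2].
    * assert (H3 := Hlow h t al' Hh Ha' (proj1 Ht)).
      assert (H4 := Hup g s be Hg Hb (proj2 Hs)). lra.
    * exfalso.
      (* The two components overlap, so they belong to the same gap by uniqueness; then [evg g be]
         would lie inside that gap, although the height of [be] is exactly 3/5. *)
      set (m := Rmax (evg g al) (evg h al')).
      assert (Hm1 := Rmax_l (evg g al) (evg h al')).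
      assert (Hm2 := Rmax_r (evg g al) (evg h al')). fold m in Hm1, Hm2.
      assert (Hm : m < evg g be) by (apply Rmax_lub_lt; lra).
      assert (E : g = h).
      { apply (in_gap_unique g h ((m + evg g be) / 2)); [apply HI | apply HI']; lra. }
      subst h. assert (Hin : in_gap g (evg g be)) by (apply HI'; lra).
      destruct Hin as [_ Hin]. rewrite evgi_evg in Hin. lra.
- destruct (gap_component g s Hg) as [al [be [Ha [Hb [Hs HI]]]]].
  rewrite (spread_out K t Hh). assert (H4 := Hup g s be Hg Hb (proj2 Hs)).
  destruct (Rlt_le_dec t (evg g be)) as [H1 | H1]; [| lra].
  exfalso. apply (Hh g), HI. lra.
- destruct (gap_component h t Hh) as [al' [be' [Ha' [Hb' [Ht HI']]]]].
  rewrite (spread_out K s Hg). assert (H3 := Hlow h t al' Hh Ha' (proj1 Ht)).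
  destruct (Rlt_le_dec (evg h al') s) as [H1 | H1]; [| lra].
  exfalso. apply (Hg h), HI'. lra.
- now rewrite !spread_out.
Qed.

(** 20000 is the constant 2 of [K] times the distortion bound 100 for each of the two factors
    [dl]. *)
Lemma gap_lipschitz (K : R -> R) (g : gap) (s t : R) : deformation K ->
  reduced (snd g) -> 3/5 <= height s -> 3/5 <= height t ->
  chord (evg g (K s)) (evg g (K t)) <= 20000 * chord (evg g s) (evg g t).
Proof.
intros HK Hg Hs Ht. destruct (gap_distortion g Hg) as [dl [Hd [E Hdl]]].
rewrite !E. destruct (HK) as [_ [_ [_ HL]]].
assert (H1 := Hdl _ _ (deformation_height_le K HK s Hs) Hs).
assert (H2 := Hdl _ _ (deformation_height_le K HK t Ht) Ht).
assert (P1 := Hd (K s)). assert (P2 := Hd (K t)).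
replace (20000 * (chord s t * dl s * dl t))
  with (2 * chord s t * ((100 * dl s) * (100 * dl t))) by ring.
rewrite Rmult_assoc. apply Rmult_le_compat.
- apply chord_nonneg.
- left. now apply Rmult_lt_0_compat.
- apply HL.
- apply Rmult_le_compat; lra.
Qed.

(* An arc joining a point of a gap to a point outside it crosses an endpoint [e]. *)
Lemma gap_endpoint (K : R -> R) (g : gap) (s t : R) : deformation K ->
  in_gap g t -> ~ in_gap g s ->
  exists e, chord t e <= chord t s /\ chord (spread K t) e <= 20000 * chord t e.
Proof.
intros HK Hg Hs. assert (HP := PI_RGT_0).
destruct (HK) as [_ [_ [Hf _]]].
assert (Hend : forall x, height x = 3/5 ->
  chord (spread K t) (evg g x) <= 20000 * chord t (evg g x)).
{ intros x Hx. rewrite (spread_in K g t Hg). destruct (Hg) as [Hw Ht].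
  assert (H := gap_lipschitz K g (evgi g t) x HK Hw ltac:(lra) ltac:(lra)).
  rewrite evg_evgi, (Hf x) in H by lra. exact H. }
destruct (gap_component g t Hg) as [al [be [Ha [Hb [Ht HI]]]]].
(* Replace [s] by a translate within 1/2 of [t]: up to there the chord increases with the distance
   on the line, so an endpoint lying in between is no farther from [t]. *)
destruct (integer_translate s (t - 1/2)) as [k Hk].
rewrite (chord_sym t s), <- (chord_add_IZR s t k), (chord_sym _ t).
rewrite <- (in_gap_add_IZR g s k) in Hs. set (s0 := s + IZR k) in *.
assert (Hmono : forall x y, 0 <= x <= y -> y <= 1/2 -> sin (PI * x) <= sin (PI * y)).
{ intros x y Hxy Hy. apply sin_incr_1; nra. }
assert (Hpos : forall x, 0 <= x <= 1/2 -> 0 <= sin (PI * x)) by (intros; apply sin_ge_0; nra).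
destruct (Rle_lt_dec s0 (evg g al)) as [H1 | H1].
- exists (evg g al). split; [| now apply Hend].
  unfold chord. rewrite !Rabs_pos_eq by (apply Hpos; lra). apply Hmono; lra.
- destruct (Rle_lt_dec (evg g be) s0) as [H2 | H2].
  + exists (evg g be). split; [| now apply Hend].
    rewrite (chord_sym t (evg g be)), (chord_sym t s0).
    unfold chord. rewrite !Rabs_pos_eq by (apply Hpos; lra). apply Hmono; lra.
  + exfalso. apply Hs, HI. lra.
Qed.

(** Two points of one gap are covered by [gap_lipschitz]. Otherwise pass from each point to an end
    of its gap, or to the point itself if it is in none: two terms with factor 20000 and three
    copies of [chord s t], 40003 in all. *)
Lemma spread_lipschitz (K : R -> R) : deformation K ->
  forall s t, chord (spread K s) (spread K t) <= 50000 * chord s t.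
Proof.
intros HK s t. assert (Hst := chord_nonneg s t).
assert (Hend : forall s t, (exists g, in_gap g t /\ in_gap g s) \/
  exists e, chord t e <= chord t s /\ chord (spread K t) e <= 20000 * chord t e).
{ intros x y. destruct (in_gap_dec y) as [[g Hg] | Hg].
  - destruct (classic (in_gap g x)) as [H | H].
    + left. now exists g.
    + right. now apply (gap_endpoint K g).
  - right. exists y. rewrite (spread_out K y Hg).
    assert (E : chord y y = 0)
      by (unfold chord; now rewrite Rminus_diag, Rmult_0_r, sin_0, Rabs_R0).
    rewrite E. split; [apply chord_nonneg | lra]. }
assert (Hboth : forall g, in_gap g s -> in_gap g t ->
  chord (spread K s) (spread K t) <= 50000 * chord s t).
{ intros g Hs Ht. rewrite (spread_in K g s Hs), (spread_in K g t Ht).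
  destruct Hs as [Hw Hs], Ht as [_ Ht].
  assert (H := gap_lipschitz K g _ _ HK Hw (Rlt_le _ _ Hs) (Rlt_le _ _ Ht)).
  rewrite !evg_evgi in H. lra. }
destruct (Hend s t) as [[g [Ht Hs]] | [e [H1 H2]]]; [now apply (Hboth g) |].
destruct (Hend t s) as [[g [Hs Ht]] | [e' [H3 H4]]]; [now apply (Hboth g) |].
rewrite (chord_sym t s) in H1.
apply Rle_trans with (1 := chord_triangle _ e' _).
apply Rle_trans with (chord (spread K s) e' + (chord e' s + (chord s t
  + (chord t e + chord e (spread K t))))).
- apply Rplus_le_compat_l.
  apply Rle_trans with (1 := chord_triangle _ s _). apply Rplus_le_compat_l.
  apply Rle_trans with (1 := chord_triangle _ t _). apply Rplus_le_compat_l.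
  apply chord_triangle.
- rewrite (chord_sym e' s), (chord_sym e (spread K t)). lra.
Qed.

(** * Intertwining of the generators by the spread deformation *)

Definition Fl : R -> R := Fpow 1.
Definition Fli : R -> R := Fpow (- 1).

(** s exchanges the two gaps that share a word. As [Sl] squares to translation by 1, one direction
    costs an integer translation, absorbed by equivariance. *)
Lemma spread_Sl (K : R -> R) : equivariant K ->
  forall t, spread K (Sl t) = Sl (spread K t).
Proof.
intros HK t.
assert (Hft : forall w u, in_gap (false, w) u -> in_gap (true, w) (Sl u)).
{ intros w u [Hw H]. split; [exact Hw |]. unfold evgi in *; simpl in *.
  now rewrite Sli_Sl. }
assert (Htf : forall w u, in_gap (true, w) u -> in_gap (false, w) (Sl u)).
{ intros w u [Hw H]. split; [exact Hw |]. unfold evgi in *; simpl in *.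
  replace (Sl u) with (Sli u + 1) by (unfold Sli; ring).
  now rewrite equivariant_evi, height_add_1. }
destruct (in_gap_dec t) as [[[[|] w] Hg] | Hg].
- rewrite (spread_in K _ t Hg), (spread_in K _ (Sl t) (Htf w t Hg)).
  unfold evg, evgi; simpl. rewrite Sl_Sl.
  replace (Sl t) with (Sli t + 1) by (unfold Sli; ring).
  now rewrite equivariant_evi, HK, equivariant_ev.
- rewrite (spread_in K _ t Hg), (spread_in K _ (Sl t) (Hft w t Hg)).
  unfold evg, evgi; simpl. now rewrite Sli_Sl.
- rewrite (spread_out K t Hg), spread_out; [reflexivity |].
  intros [[|] w] H.
  + apply Htf in H. rewrite Sl_Sl in H.
    now apply (Hg (false, w)), (in_gap_add_IZR _ t 1).
  + apply Hft in H. rewrite Sl_Sl in H.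
    now apply (Hg (true, w)), (in_gap_add_IZR _ t 1).
Qed.

(* The arc [3/5 < height] is a fundamental domain for f on the upper half circle,
   where the gaps are its images under the positive powers of f. *)
Lemma not_in_gap_high (g : gap) (t : R) : 3/5 < height t -> ~ in_gap g t.
Proof.
intros Ht [Hw H]. destruct g as [[|] w]; unfold evgi in H; simpl in *.
- assert (H1 := height_ev w Hw (evi w (Sli t)) ltac:(lra)). rewrite ev_evi in H1.
  apply Sl_contracts in H1. rewrite Sl_Sli in H1. lra.
- destruct w as [n | m w]; cbn [evi] in H.
  + assert (E : (- Z.of_nat (S n))%Z = 0%Z)
      by (apply (height_large_Fpow _ t); now apply Rabs_pos_large).
    lia.
  + destruct Hw as [Hm Hw].
    assert (H1 := height_ev w Hw _ (Rlt_le _ _ H)). rewrite ev_evi in H1.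
    apply Sl_contracts in H1. rewrite Sl_Sli in H1.
    assert (H2 := height_scaling_pos (powerRZ 9 (- m)) t (pow9_pos _) ltac:(lra)).
    unfold Fpow in H1. lra.
Qed.

(** Left multiplication of a reduced word by f: it changes the leading power of f, or creates one
    before s, or cancels a leading [f^(-1)], after which the word begins with s. *)
Lemma in_gap_Fl (g : gap) (t : R) : in_gap g t ->
  exists g', in_gap g' (Fl t) /\ (forall u, evg g' u = Fl (evg g u)).
Proof.
intros Hg.
assert (E : exists g', reduced (snd g') /\ forall u, evg g' u = Fl (evg g u)).
{ destruct Hg as [Hw _]. destruct g as [[|] w].
  - exists (false, Step 1 w). split; [split; [lia | exact Hw] | reflexivity].
  - destruct w as [n | m w].
    + exists (false, Power (S n)). split; [exact I |]. intros u.
      unfold evg, Fl; cbn [fst snd ev]. rewrite Fpow_add. f_equal. lia.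
    + destruct Hw as [Hm Hw]. destruct (Z.eq_dec (1 + m) 0) as [Hz | Hz].
      * exists (true, w). split; [exact Hw |]. intros u.
        unfold evg, Fl; cbn [fst snd ev]. now rewrite Fpow_add, Hz, Fpow_0.
      * exists (false, Step (1 + m) w). split; [split; assumption |]. intros u.
        unfold evg, Fl; cbn [fst snd ev]. now rewrite Fpow_add. }
destruct E as [g' [Hw' E]]. exists g'. split; [| exact E]. split; [exact Hw' |].
destruct Hg as [_ Hg]. rewrite <- (evg_evgi g t), <- E, evgi_evg. exact Hg.
Qed.

(** Left division of the word by f. It fails only for the word f itself, whose arc comes from D, and
    this is the case that the hypothesis on [height t] rules out. *)
Lemma in_gap_Fli (g : gap) (t : R) : in_gap g (Fl t) -> ~ 3/5 < height t ->
  exists g', in_gap g' t.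
Proof.
intros Hg Ht.
assert (E : exists g', reduced (snd g') /\ forall u, evg g u = Fl (evg g' u)).
{ destruct Hg as [Hw H]. destruct g as [[|] w].
  - exists (false, Step (- 1) w). split; [split; [lia | exact Hw] |]. intros u.
    unfold evg, Fl; cbn [fst snd ev]. now rewrite Fpow_opp_r.
  - destruct w as [[|n] | m w].
    + exfalso. apply Ht. unfold evgi, Fl in H; cbn [fst snd evi] in H.
      rewrite Fpow_add in H. change (height (Fpow 0 t) > 3/5) in H.
      now rewrite Fpow_0 in H.
    + exists (false, Power n). split; [exact I |]. intros u.
      unfold evg, Fl; cbn [fst snd ev]. rewrite Fpow_add. f_equal. lia.
    + destruct Hw as [Hm Hw]. destruct (Z.eq_dec (m - 1) 0) as [Hz | Hz].
      * exists (true, w). split; [exact Hw |]. intros u.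
        unfold evg, Fl; cbn [fst snd ev]. replace m with 1%Z by lia. reflexivity.
      * exists (false, Step (m - 1) w). split; [split; assumption |]. intros u.
        unfold evg, Fl; cbn [fst snd ev]. rewrite Fpow_add. f_equal. lia. }
destruct E as [g' [Hw' E]]. exists g'. split; [exact Hw' |].
destruct Hg as [_ Hg].
replace t with (evg g' (evgi g (Fl t))); [now rewrite evgi_evg |].
apply (increasing_inj Fl); [apply scaling_increasing, pow9_pos |].
rewrite <- E. apply evg_evgi.
Qed.

(** The relation [phi f = f k phi]. On D, phi is the identity, and on f(D) it is [f k f^(-1)].
    Elsewhere [K] is the identity at [spread K t], while f carries gaps to gaps and points outside
    the gaps to such points. *)
Lemma spread_Fl (K : R -> R) : deformation K ->
  forall t, spread K (Fl t) = Fl (K (spread K t)).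
Proof.
intros HK t. destruct (HK) as [_ [_ [Hf _]]].
destruct (Rlt_le_dec (3/5) (height t)) as [Ht | Ht].
- rewrite (spread_out K t) by (intros g; now apply not_in_gap_high).
  rewrite (spread_in K (false, Power 0)).
  + unfold evg, evgi, Fl; cbn [fst snd ev evi].
    f_equal. f_equal. rewrite Fpow_add. apply Fpow_0.
  + split; [exact I |]. unfold evgi, Fl; cbn [fst snd ev evi].
    rewrite Fpow_add. change (3/5 < height (Fpow 0 t)). now rewrite Fpow_0.
- destruct (in_gap_dec t) as [[g Hg] | Hg].
  + destruct (in_gap_Fl g t Hg) as [g' [Hg' E]].
    rewrite (spread_in K g' _ Hg').
    assert (Ei : evgi g' (Fl t) = evgi g t).
    { rewrite <- (evg_evgi g t) at 1. rewrite <- E. apply evgi_evg. }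
    rewrite Ei, E, <- (spread_in K g t Hg). f_equal. symmetry. apply Hf.
    apply Rnot_lt_le. intros H.
    apply (not_in_gap_high g _ H). now apply in_gap_spread.
  + rewrite (spread_out K t Hg), (Hf t Ht). apply spread_out.
    intros g H. destruct (in_gap_Fli g t H ltac:(lra)) as [g' H']. now apply (Hg g').
Qed.

(** The lift of k: a push forward on the arc of height above 3/5, smooth at its ends thanks to
    [flat 0]. The factor 1/100 makes the Lipschitz constant of the displacement small against 1. *)
Definition Kl (t : R) : R := t + 1/100 * flat 0 (height t - 3/5).

(** 4 is the bound [2 ^ 2] on [flat 2], the derivative of [flat 0]. *)
Lemma flat0_lipschitz (x y : R) : Rabs (flat 0 y - flat 0 x) <= 4 * Rabs (y - x).
Proof.
apply (bounded_variation (flat 0) (fun t => flat 2 t - INR 0 * flat 1 t)).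
intros t _. split; [apply is_derive_flat |].
replace (flat 2 t - INR 0 * flat 1 t) with (flat 2 t) by (simpl; ring).
generalize (flat_bound 2 t). simpl. intros H. rewrite Rabs_pos_eq; lra.
Qed.

Lemma flat0_height (s t : R) :
  Rabs (flat 0 (height t - 3/5) - flat 0 (height s - 3/5)) <= 8 * chord s t.
Proof.
apply Rle_trans with (1 := flat0_lipschitz _ _).
replace (height t - 3/5 - (height s - 3/5)) with (height t - height s) by ring.
generalize (height_chord t s). rewrite (chord_sym t s). lra.
Qed.

Lemma chord_le_dist (s t : R) : chord s t <= PI * Rabs (s - t).
Proof.
unfold chord. apply Rle_trans with (1 := Rabs_sin_le _).
rewrite Rabs_mult, (Rabs_pos_eq PI); [lra | generalize PI_RGT_0; lra].
Qed.

(** The displacement has Lipschitz constant at most [8 * PI / 100 < 1/2]. The linear lower bound is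
    stronger than monotonicity: it gives the nonvanishing derivative behind the smoothness of the
    inverse. *)
Lemma Kl_expand (s t : R) : s < t -> (t - s) / 2 <= Kl t - Kl s.
Proof.
intros H. unfold Kl. assert (H1 := flat0_height s t). assert (H2 := chord_le_dist s t).
rewrite (Rabs_left (s - t)) in H2 by lra.
apply Rabs_le_between in H1. generalize PI_4. nra.
Qed.

Lemma Kl_increasing (s t : R) : s < t -> Kl s < Kl t.
Proof. intros H. generalize (Kl_expand s t H). lra. Qed.

Lemma Sm_height : Sm height.
Proof.
unfold height. apply (Sm_comp sin (fun t => 2 * PI * t)); [apply Sm_sin |].
apply Sm_mult; [apply Sm_const | apply Sm_id].
Qed.

Lemma Sm_Kl : Sm Kl.
Proof.
unfold Kl. apply Sm_plus; [apply Sm_id |]. apply Sm_mult; [apply Sm_const |].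
apply (Sm_comp (flat 0) (fun t => height t - 3/5)); [apply Sm_flat |].
apply (Sm_plus height (fun _ => - (3/5))); [apply Sm_height | apply Sm_const].
Qed.

Lemma Kl_surj (y : R) : exists t, Kl t = y.
Proof.
destruct (IVT (fun t => Kl t - y) (y - 1) (y + 1)) as [t [_ Ht]].
- intros t. apply continuity_pt_minus.
  + apply continuity_pt_filterlim, Sm_continuous, Sm_Kl.
  + apply continuity_pt_const. intros u v. reflexivity.
- lra.
- unfold Kl. generalize (flat_bound 0 (height (y - 1) - 3/5)). simpl. lra.
- unfold Kl. generalize (flat_bound 0 (height (y + 1) - 3/5)). simpl. lra.
- exists t. lra.
Qed.

Definition Kli (y : R) : R :=
  proj1_sig (constructive_indefinite_description _ (Kl_surj y)).

Lemma Kl_Kli (y : R) : Kl (Kli y) = y.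
Proof. exact (proj2_sig (constructive_indefinite_description _ (Kl_surj y))). Qed.

Lemma Kli_Kl (y : R) : Kli (Kl y) = y.
Proof. apply (increasing_inj Kl Kl_increasing), Kl_Kli. Qed.

Lemma Sm_Kli : Sm Kli.
Proof.
destruct (Sm_derive Kl Sm_Kl) as [K' [HK' D]].
apply (Sm_recip Kl K' Kli HK' D); [| exact Kl_increasing | exact Kl_Kli].
(* A zero derivative would give a difference quotient below 1/4, against the lower bound 1/2 from
   [Kl_expand]. *)
intros t H0. assert (Dt := D t). rewrite H0 in Dt. apply is_derive_Reals in Dt.
destruct (Dt (1/4) ltac:(lra)) as [del Hd]. assert (Hp := cond_pos del).
specialize (Hd (del / 2) ltac:(lra)). rewrite Rabs_pos_eq in Hd by lra.
specialize (Hd ltac:(lra)). rewrite Rminus_0_r in Hd. apply Rabs_def2 in Hd.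
assert (H := Kl_expand t (t + del / 2) ltac:(lra)).
assert (H1 : 1/2 <= (Kl (t + del / 2) - Kl t) / (del / 2)).
{ apply Rmult_le_reg_r with (del / 2); [lra |].
  replace ((Kl (t + del / 2) - Kl t) / (del / 2) * (del / 2))
    with (Kl (t + del / 2) - Kl t) by (field; lra). lra. }
lra.
Qed.

Lemma equivariant_Kl : equivariant Kl.
Proof. intros t. unfold Kl. rewrite height_add_1. ring. Qed.

Lemma equivariant_Kli : equivariant Kli.
Proof.
intros t. apply (increasing_inj Kl Kl_increasing).
now rewrite equivariant_Kl, !Kl_Kli.
Qed.

Lemma Kl_fixed (t : R) : height t <= 3/5 -> Kl t = t.
Proof.
intros H. unfold Kl, flat. destruct (Rlt_dec 0 (height t - 3/5)); lra.
Qed.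

(** With [e] the difference of the displacements, as an angle, [|sin e|] is at most 0.32 times
    [chord s t]. Both bounds follow from the subadditivity of [|sin|], as [1.32 <= 2] and
    [1 <= 2 * 0.68]. *)
Lemma chord_Kl (s t : R) :
  chord (Kl s) (Kl t) <= 2 * chord s t /\ chord s t <= 2 * chord (Kl s) (Kl t).
Proof.
assert (HP := PI_RGT_0). assert (HP4 := PI_4).
assert (H0 := chord_nonneg s t).
set (e := PI * (1/100 * (flat 0 (height s - 3/5) - flat 0 (height t - 3/5)))).
assert (He : Rabs (sin e) <= 32/100 * chord s t).
{ apply Rle_trans with (1 := Rabs_sin_le _). unfold e.
  rewrite !Rabs_mult, (Rabs_pos_eq PI), (Rabs_pos_eq (1/100)) by lra.
  assert (H1 := flat0_height t s). rewrite chord_sym in H1.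
  apply Rle_trans with (PI * (1/100 * (8 * chord s t))); [| nra].
  apply Rmult_le_compat_l; lra. }
split.
- replace (chord (Kl s) (Kl t)) with (Rabs (sin (PI * (s - t) + e)))
    by (unfold chord, Kl, e; do 2 f_equal; ring).
  apply Rle_trans with (1 := Rabs_sin_plus _ _). fold (chord s t). lra.
- assert (H : chord s t <= chord (Kl s) (Kl t) + 32/100 * chord s t); [| lra].
  replace (chord s t) with (Rabs (sin (PI * (Kl s - Kl t) + - e))) at 1
    by (unfold chord, Kl, e; do 2 f_equal; ring).
  apply Rle_trans with (1 := Rabs_sin_plus _ _).
  rewrite (sin_neg e), Rabs_Ropp. fold (chord (Kl s) (Kl t)). lra.
Qed.

Lemma deformation_Kl : deformation Kl.
Proof.
split; [exact equivariant_Kl |]. split; [exact Kl_increasing |].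
split; [exact Kl_fixed |]. intros s t. apply chord_Kl.
Qed.

Lemma deformation_Kli : deformation Kli.
Proof.
split; [exact equivariant_Kli |].
split; [exact (increasing_recip Kl Kli Kl_increasing Kl_Kli) |].
split.
- intros t Ht. rewrite <- (Kl_fixed t Ht) at 1. apply Kli_Kl.
- intros s t. rewrite <- (Kl_Kli s) at 2. rewrite <- (Kl_Kli t) at 2. apply chord_Kl.
Qed.

(** * The groups *)

(** There is no constructor for inverses: the lists in use contain the inverses of their members, so
    this monoid is already a group. *)
Inductive generated (l : list (circle -> circle)) : (circle -> circle) -> Prop :=
| gen_id : generated l (fun x => x)
| gen_in f : In f l -> generated l f
| gen_comp f g : generated l f -> generated l g -> generated l (fun x => f (g x)).

Lemma inverses_comp (f f' g g' : circle -> circle) :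
  inverses f f' -> inverses g g' ->
  inverses (fun x => f (g x)) (fun x => g' (f' x)).
Proof.
intros [H1 H2] [H3 H4]. split; intros x.
- now rewrite H1, H3.
- now rewrite H4, H2.
Qed.

Lemma inverses_unique (f g h : circle -> circle) :
  inverses f g -> inverses f h -> g = h.
Proof.
intros [H1 H2] [H3 H4]. apply functional_extensionality. intros x.
rewrite <- (H4 x) at 1. apply H1.
Qed.

Lemma generated_group (l : list (circle -> circle)) :
  (forall f, In f l -> exists g, In g l /\ inverses f g) -> is_group (generated l).
Proof.
intros Hl. split; [apply gen_id |]. split; [exact (gen_comp l) |].
intros f Hf. induction Hf as [| f Hf | f g _ [f' [Hf' If]] _ [g' [Hg' Ig]]].
- exists (fun x => x). split; [apply gen_id | now split].
- destruct (Hl f Hf) as [g [Hg I]]. exists g. split; [now apply gen_in | exact I].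
- exists (fun x => g' (f' x)). split; [now apply gen_comp | now apply inverses_comp].
Qed.

Lemma generated_fg (l : list (circle -> circle)) : finitely_generated (generated l).
Proof.
exists l. split; [exact (gen_in l) |].
intros H [H1 [H2 _]] Hl f Hf. induction Hf; auto.
Qed.

Definition smooth_lift (f : circle -> circle) : Prop :=
  exists F, lift_of F f /\ Sm F /\ (forall s t, s < t -> F s < F t).

Lemma smooth_lift_circ (F : R -> R) : equivariant F -> Sm F ->
  (forall s t, s < t -> F s < F t) -> smooth_lift (circ F).
Proof.
intros HF HS HI. exists F. split; [| now split]. split.
- now apply Sm_continuous.
- now apply circ_cover.
Qed.

Lemma generated_smooth (l : list (circle -> circle)) :
  (forall f, In f l -> exists g, In g l /\ inverses f g) ->
  (forall f, In f l -> smooth_lift f) -> smooth_diffeo_group (generated l).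
Proof.
intros Hinv Hl. assert (HG := generated_group l Hinv). split; [exact HG |].
assert (Hlift : forall f, generated l f -> smooth_lift f).
{ intros f Hf. induction Hf as [| f Hf | f g _ [F [[CF LF] [SF IF]]] _ [G [[CG LG] [SG IG]]]].
  - exists (fun t => t). split; [| split; [apply Sm_id | auto]].
    split; [intros t; apply continuous_id | reflexivity].
  - auto.
  - exists (fun t => F (G t)).
    assert (SFG : Sm (fun t => F (G t))) by now apply Sm_comp.
    split; [| split; [exact SFG | auto]].
    split; [now apply Sm_continuous |]. intros t. now rewrite LG, LF. }
assert (Hsm : forall f, generated l f -> smooth_map f).
{ intros f Hf k. destruct (Hlift f Hf) as [F [LF [SF _]]].
  exists F. split; [exact LF | now apply Sm_Ck_real]. }
intros f Hf. split.
- destruct HG as [_ [_ HI]]. destruct (HI f Hf) as [g [Hg I]].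
  exists g. auto.
- destruct (Hlift f Hf) as [F [LF [_ IF]]]. now exists F.
Qed.

Lemma generated_conj (l1 l2 : list (circle -> circle)) (phi phi' : circle -> circle) :
  inverses phi phi' ->
  (forall f, In f l1 -> generated l2 (fun x => phi (f (phi' x)))) ->
  forall f, generated l1 f -> generated l2 (fun x => phi (f (phi' x))).
Proof.
intros [H1 H2] Hl f Hf. induction Hf as [| f Hf | f g _ IHf _ IHg].
- replace (fun x => phi (phi' x)) with (fun x : circle => x); [apply gen_id |].
  apply functional_extensionality. intros x. now rewrite H2.
- auto.
- replace (fun x => phi (f (g (phi' x))))
    with (fun x => phi (f (phi' (phi (g (phi' x)))))).
  + exact (gen_comp l2 _ _ IHf IHg).
  + apply functional_extensionality. intros x. now rewrite H1.
Qed.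

Definition Gl (t : R) : R := Fl (Kl t).
Definition Gli (t : R) : R := Kli (Fli t).

Definition gens1 : list (circle -> circle) := circ Fl :: circ Fli :: circ Sl :: circ Sli :: nil.
Definition gens2 : list (circle -> circle) := circ Gl :: circ Gli :: circ Sl :: circ Sli :: nil.

Lemma equivariant_Fl : equivariant Fl.
Proof. apply equivariant_scaling. Qed.
Lemma equivariant_Fli : equivariant Fli.
Proof. apply equivariant_scaling. Qed.
Lemma equivariant_Gl : equivariant Gl.
Proof. exact (equivariant_comp _ _ equivariant_Fl equivariant_Kl). Qed.
Lemma equivariant_Gli : equivariant Gli.
Proof. exact (equivariant_comp _ _ equivariant_Kli equivariant_Fli). Qed.

#[local] Hint Resolve equivariant_Fl equivariant_Fli equivariant_Gl equivariant_Gli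
  equivariant_Sl equivariant_Sli : core.

Lemma inverses_sym (f g : circle -> circle) : inverses f g -> inverses g f.
Proof. intros [H1 H2]. now split. Qed.

Lemma inverses_Fl : inverses (circ Fl) (circ Fli).
Proof.
apply circ_inverses; auto; intros t; unfold Fl, Fli;
  [apply Fpow_opp | apply Fpow_opp_r].
Qed.

Lemma inverses_Sl : inverses (circ Sl) (circ Sli).
Proof. apply circ_inverses; auto using Sli_Sl, Sl_Sli. Qed.

Lemma inverses_Gl : inverses (circ Gl) (circ Gli).
Proof.
apply circ_inverses; auto; intros t; unfold Gl, Gli, Fl, Fli.
- now rewrite (Fpow_opp 1), Kli_Kl.
- now rewrite Kl_Kli, (Fpow_opp_r 1).
Qed.

Lemma gens1_inverses (f : circle -> circle) :
  In f gens1 -> exists g, In g gens1 /\ inverses f g.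
Proof.
unfold gens1. simpl. intros [<- | [<- | [<- | [<- | []]]]].
- exists (circ Fli). split; [tauto | apply inverses_Fl].
- exists (circ Fl). split; [tauto | apply inverses_sym, inverses_Fl].
- exists (circ Sli). split; [tauto | apply inverses_Sl].
- exists (circ Sl). split; [tauto | apply inverses_sym, inverses_Sl].
Qed.

Lemma gens2_inverses (f : circle -> circle) :
  In f gens2 -> exists g, In g gens2 /\ inverses f g.
Proof.
unfold gens2. simpl. intros [<- | [<- | [<- | [<- | []]]]].
- exists (circ Gli). split; [tauto | apply inverses_Gl].
- exists (circ Gl). split; [tauto | apply inverses_sym, inverses_Gl].
- exists (circ Sli). split; [tauto | apply inverses_Sl].
- exists (circ Sl). split; [tauto | apply inverses_sym, inverses_Sl].
Qed.

Lemma Fl_increasing (s t : R) : s < t -> Fl s < Fl t.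
Proof. apply scaling_increasing, pow9_pos. Qed.

Lemma Fli_increasing (s t : R) : s < t -> Fli s < Fli t.
Proof. apply scaling_increasing, pow9_pos. Qed.

Lemma smooth_lift_Sl : smooth_lift (circ Sl).
Proof. apply smooth_lift_circ; auto using Sm_Sl, Sl_increasing. Qed.

Lemma smooth_lift_Sli : smooth_lift (circ Sli).
Proof.
apply smooth_lift_circ; auto.
- apply (Sm_plus Sl (fun _ => - (1))); [apply Sm_Sl | apply Sm_const].
- intros s t H. unfold Sli. apply Sl_increasing in H. lra.
Qed.

Lemma gens1_smooth (f : circle -> circle) : In f gens1 -> smooth_lift f.
Proof.
unfold gens1. simpl. intros [<- | [<- | [<- | [<- | []]]]];
  auto using smooth_lift_Sl, smooth_lift_Sli; apply smooth_lift_circ;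
  auto using Fl_increasing, Fli_increasing; apply Sm_scaling, pow9_pos.
Qed.

Lemma gens2_smooth (f : circle -> circle) : In f gens2 -> smooth_lift f.
Proof.
unfold gens2. simpl. intros [<- | [<- | [<- | [<- | []]]]];
  auto using smooth_lift_Sl, smooth_lift_Sli; apply smooth_lift_circ; auto.
- apply (Sm_comp Fl Kl); [apply Sm_scaling, pow9_pos | apply Sm_Kl].
- intros s t H. now apply Fl_increasing, Kl_increasing.
- apply (Sm_comp Kli Fli); [apply Sm_Kli | apply Sm_scaling, pow9_pos].
- intros s t H. apply (increasing_recip Kl Kli Kl_increasing Kl_Kli).
  now apply Fli_increasing.
Qed.

(** [f^(m - n)] brings [t] back to the lower fundamental domain, which only the trivial power can
    do. *)
Lemma Fpow_orbit_inj (t : R) (m n : Z) : height t < - (3/5) ->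
  cover (Fpow m t) = cover (Fpow n t) -> m = n.
Proof.
intros Ht H. apply cover_eq in H. destruct H as [k Hk].
assert (E : (- n + m)%Z = 0%Z); [| lia].
apply (height_large_Fpow _ t); [now apply Rabs_neg_large |].
rewrite <- Fpow_add, Hk. unfold Fpow.
rewrite (equivariant_IZR _ (equivariant_scaling _)), height_add_IZR.
fold (Fpow n t). fold (Fpow (- n) (Fpow n t)). rewrite Fpow_opp.
now apply Rabs_neg_large.
Qed.

(** [f] is prescribed only on the lower half circle, where f and f_2 agree, so both groups are
    covered. Every orbit meets the region below height -3/5, after at most one application of s, and
    the forward orbit under f of such a point is infinite and stays in the lower half circle. *)
Lemma infinite_orbits (G : (circle -> circle) -> Prop) (f s : circle -> circle) :
  is_group G -> G f -> G s ->
  (forall t, height t < 0 -> f (cover t) = cover (Fl t)) ->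
  (forall t, s (cover t) = cover (Sl t)) ->
  without_finite_orbits G.
Proof.
intros [Hid [Hcomp _]] Gf Gs Hf Hs x [l Hl].
assert (Hz : exists t h, G h /\ h x = cover t /\ height t < - (3/5)).
{ destruct (cover_surj x) as [t Ht].
  destruct (Rlt_le_dec (height t) (- (3/5))) as [H | H].
  - exists t, (fun y => y). auto.
  - exists (Sl t), s. split; [exact Gs |]. split; [now rewrite <- Ht |].
    generalize (Sl_contracts t H). lra. }
destruct Hz as [t [h [Gh [Hh Ht]]]].
assert (Horb : forall n : nat, exists g, G g /\ g x = cover (Fpow (Z.of_nat n) t)).
{ intros n. induction n as [|n [g [Gg Hg]]].
  - exists h. split; [exact Gh |]. now rewrite Fpow_0.
  - exists (fun y => f (g y)). split; [now apply Hcomp |].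
    rewrite Hg, Hf.
    + unfold Fl. rewrite Fpow_add. do 2 f_equal. lia.
    + apply height_scaling_neg; [apply pow9_pos | lra]. }
set (p := fun n : nat => cover (Fpow (Z.of_nat n) t)).
assert (Hnd : NoDup (map p (seq 0 (S (length l))))).
{ apply Injective_map_NoDup; [| apply seq_NoDup].
  intros m n E. apply Nat2Z.inj. now apply (Fpow_orbit_inj t). }
assert (Hinc : incl (map p (seq 0 (S (length l)))) l).
{ intros y Hy. apply in_map_iff in Hy. destruct Hy as [n [<- _]]. apply Hl.
  destruct (Horb n) as [g [Gg Hg]]. exists g. split; [exact Gg | now symmetry]. }
generalize (NoDup_incl_length Hnd Hinc). rewrite length_map, length_seq. lia.
Qed.

Lemma height_0 : height 0 = 0.
Proof. unfold height. rewrite Rmult_0_r. apply sin_0. Qed.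

(** The point 1 is fixed, whereas a point of height -15/17 is moved because it lies in the lower
    fundamental domain. *)
Lemma non_free (G : (circle -> circle) -> Prop) (f : circle -> circle) :
  G f -> (forall t, height t <= 0 -> f (cover t) = cover (Fl t)) ->
  acts_non_freely G.
Proof.
intros Gf Hf. exists f. split; [exact Gf |]. split.
- intros E. destruct height_fixed_exists as [c Hc].
  assert (H : cover (Fpow 1 c) = cover (Fpow 0 c)).
  { rewrite Fpow_0. fold Fl. rewrite <- Hf, E; [reflexivity | lra]. }
  apply Fpow_orbit_inj in H; [discriminate | lra].
- exists (cover 0). rewrite Hf by (rewrite height_0; lra).
  unfold Fl, Fpow. now rewrite scaling_0.
Qed.

Lemma Gl_low (t : R) : height t <= 0 -> circ Gl (cover t) = cover (Fl t).
Proof. intros H. rewrite circ_cover by auto. unfold Gl. rewrite Kl_fixed; [reflexivity | lra]. Qed.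

Lemma group1 : smooth_diffeo_group (generated gens1) /\ finitely_generated (generated gens1) /\
  acts_non_freely (generated gens1) /\ without_finite_orbits (generated gens1).
Proof.
split; [exact (generated_smooth gens1 gens1_inverses gens1_smooth) |].
split; [apply generated_fg |]. split.
- apply (non_free _ (circ Fl)); [apply gen_in; now left |].
  intros t _. now apply circ_cover.
- apply (infinite_orbits _ (circ Fl) (circ Sl)).
  + exact (generated_group gens1 gens1_inverses).
  + apply gen_in. now left.
  + apply gen_in. right. right. now left.
  + intros t _. now apply circ_cover.
  + intros t. now apply circ_cover.
Qed.

Lemma group2 : smooth_diffeo_group (generated gens2) /\ finitely_generated (generated gens2) /\
  acts_non_freely (generated gens2) /\ without_finite_orbits (generated gens2).
Proof.
split; [exact (generated_smooth gens2 gens2_inverses gens2_smooth) |].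
split; [apply generated_fg |]. split.
- apply (non_free _ (circ Gl)); [apply gen_in; now left | exact Gl_low].
- apply (infinite_orbits _ (circ Gl) (circ Sl)).
  + exact (generated_group gens2 gens2_inverses).
  + apply gen_in. now left.
  + apply gen_in. right. right. now left.
  + intros t H. apply Gl_low. lra.
  + intros t. now apply circ_cover.
Qed.

(** * The bi-Lipschitz conjugacy *)

Lemma lipschitz_circ (F : R -> R) (L : R) : equivariant F ->
  (forall s t, chord (F s) (F t) <= L * chord s t) -> lipschitz (circ F).
Proof.
intros HF HL. exists L. intros p q.
destruct (cover_surj p) as [s <-]. destruct (cover_surj q) as [t <-].
rewrite !circ_cover, !circle_dist_cover by exact HF.
generalize (HL s t). lra.
Qed.

(** The inverse of phi is the spread of the inverse of k, so one Lipschitz estimate serves both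
    directions. The conjugation is checked on generators. *)
Lemma bilipschitz_conjugacy : exists phi : circle -> circle,
  bilipschitz_homeo phi /\ orientation_preserving phi /\
  conjugates phi (generated gens1) (generated gens2).
Proof.
assert (EP : equivariant (spread Kl)) by exact (equivariant_spread Kl equivariant_Kl).
assert (EP' : equivariant (spread Kli)) by exact (equivariant_spread Kli equivariant_Kli).
assert (I1 := spread_inverse Kl Kli deformation_Kl deformation_Kli Kl_Kli).
assert (I2 := spread_inverse Kli Kl deformation_Kli deformation_Kl Kli_Kl).
assert (Inv : inverses (circ (spread Kl)) (circ (spread Kli)))
  by (apply circ_inverses; assumption).
exists (circ (spread Kl)). split; [| split].
- exists (circ (spread Kli)). split; [exact Inv |]. split.
  + apply (lipschitz_circ _ 50000 EP), spread_lipschitz, deformation_Kl.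
  + apply (lipschitz_circ _ 50000 EP'), spread_lipschitz, deformation_Kli.
- exists (spread Kl). assert (HI := spread_increasing Kl deformation_Kl).
  split; [| exact HI]. split; [| now apply circ_cover].
  now apply (continuous_of_increasing _ (spread Kli)).
- exists (circ (spread Kli)). split; [exact Inv |].
  (* An intertwining relation passes to the inverse maps and to the inverse conjugacy, so one
     relation for f and one for s settle all generators. *)
  assert (Hconj : forall (f f' g g' : circle -> circle) (phi phi' : circle -> circle),
    inverses phi phi' -> inverses f f' -> inverses g g' ->
    (forall x, phi (f x) = g (phi x)) ->
    (fun x => phi (f (phi' x))) = g /\ (fun x => phi (f' (phi' x))) = g' /\
    (fun x => phi' (g (phi x))) = f /\ (fun x => phi' (g' (phi x))) = f').
  { intros f f' g g' phi phi' [P1 P2] [F1 F2] [G1 G2] H.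
    assert (H' : forall x, phi (f' x) = g' (phi x)).
    { intros x. rewrite <- (G1 (phi (f' x))), <- H, F2. reflexivity. }
    repeat split; apply functional_extensionality; intros x.
    - now rewrite H, P2.
    - now rewrite H', P2.
    - now rewrite <- H, P1.
    - now rewrite <- H', P1. }
  assert (HF : forall x, circ (spread Kl) (circ Fl x) = circ Gl (circ (spread Kl) x)).
  { intros x. destruct (cover_surj x) as [t <-].
    rewrite !circ_cover by auto. now rewrite (spread_Fl Kl deformation_Kl). }
  assert (HS : forall x, circ (spread Kl) (circ Sl x) = circ Sl (circ (spread Kl) x)).
  { intros x. destruct (cover_surj x) as [t <-].
    rewrite !circ_cover by auto. now rewrite (spread_Sl Kl equivariant_Kl). }
  destruct (Hconj _ _ _ _ _ _ Inv inverses_Fl inverses_Gl HF) as [A1 [A2 [A3 A4]]].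
  destruct (Hconj _ _ _ _ _ _ Inv inverses_Sl inverses_Sl HS) as [B1 [B2 [B3 B4]]].
  assert (C1 : forall f, generated gens1 f ->
    generated gens2 (fun x => circ (spread Kl) (f (circ (spread Kli) x)))).
  { apply (generated_conj _ _ _ _ Inv).
    unfold gens1; simpl. intros f [<- | [<- | [<- | [<- | []]]]];
      rewrite ?A1, ?A2, ?B1, ?B2; apply gen_in; simpl; tauto. }
  assert (C2 : forall g, generated gens2 g ->
    generated gens1 (fun x => circ (spread Kli) (g (circ (spread Kl) x)))).
  { apply (generated_conj _ _ _ _ (inverses_sym _ _ Inv)).
    unfold gens2; simpl. intros f [<- | [<- | [<- | [<- | []]]]];
      rewrite ?A3, ?A4, ?B3, ?B4; apply gen_in; simpl; tauto. }
  intros g. split.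
  + intros Hg. exists (fun x => circ (spread Kli) (g (circ (spread Kl) x))).
    split; [now apply C2 |]. apply functional_extensionality. intros x.
    destruct Inv as [_ H]. now rewrite !H.
  + intros [f [Hf ->]]. now apply C1.
Qed.

(** * Absence of a C^1 conjugacy *)

(** The identity of [moebius] on the circle itself, because an element of the generated group comes
    without a chosen lift. *)
Definition circle_moebius (g : circle -> circle) : Prop :=
  exists dl : circle -> R, (forall z, 0 < dl z) /\
    forall z w, circle_dist (g z) (g w) = circle_dist z w * dl z * dl w.

Lemma circle_moebius_circ (F : R -> R) : moebius F -> circle_moebius (circ F).
Proof.
intros [dl [Hd E]]. exists (fun z => dl (angle z)). split; [auto |].
intros z w. rewrite <- (cover_angle z) at 2. rewrite <- (cover_angle w) at 2.
unfold circ. rewrite !circle_dist_cover, E. ring.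
Qed.

Lemma moebius_generated (f : circle -> circle) : generated gens1 f -> circle_moebius f.
Proof.
intros Hf. induction Hf as [| f Hf | f g _ [df [Pf Ef]] _ [dg [Pg Eg]]].
- exists (fun _ => 1). split; intros; lra.
- unfold gens1 in Hf; simpl in Hf.
  destruct Hf as [<- | [<- | [<- | [<- | []]]]]; apply circle_moebius_circ.
  + apply moebius_scaling, pow9_pos.
  + apply moebius_scaling, pow9_pos.
  + exact moebius_Sl.
  + destruct moebius_Sl as [dl [Hd E]]. exists dl. split; [exact Hd |].
    intros s t. rewrite <- E. unfold Sli, chord. do 3 f_equal. ring.
- exists (fun z => df (g z) * dg z). split.
  + intros z. now apply Rmult_lt_0_compat.
  + intros z w. rewrite Ef, Eg. ring.
Qed.

Lemma lim_seq_quotient (f : R -> R) (e l : R) (u : nat -> R) :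
  is_derive f e l -> f e = 0 -> is_lim_seq u e -> (forall n, u n <> e) ->
  is_lim_seq (fun n => f (u n) / (u n - e)) l.
Proof.
intros Hd H0 Hu Hne. apply is_derive_Reals in Hd. apply is_lim_seq_spec.
apply is_lim_seq_spec in Hu. intros eps. destruct (Hd eps (cond_pos eps)) as [del Hdel].
destruct (Hu del) as [N HN]. exists N. intros n Hn. specialize (HN n Hn).
assert (Hh : u n - e <> 0) by (intros E; apply (Hne n); lra).
specialize (Hdel (u n - e) Hh HN). rewrite H0, Rminus_0_r in Hdel.
replace (e + (u n - e)) with (u n) in Hdel by ring. exact Hdel.
Qed.

(** Numerator and denominator, divided by [u n - e], tend in absolute value to [PI * |l|] and
    [PI]. *)
Lemma lim_seq_chord_quotient (A : R -> R) (e l : R) (u : nat -> R) :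
  is_derive A e l -> is_lim_seq u e -> (forall n, chord (u n) e <> 0) ->
  is_lim_seq (fun n => chord (A (u n)) (A e) / chord (u n) e) (Rabs l).
Proof.
intros Hd Hu Hne. assert (HP := PI_RGT_0).
assert (Hue : forall n, u n <> e).
{ intros n E. apply (Hne n). rewrite E. unfold chord.
  now rewrite Rminus_diag, Rmult_0_r, sin_0, Rabs_R0. }
assert (Hgen : forall C : R -> R, forall k, is_derive C e k ->
  is_lim_seq (fun n => Rabs (sin (PI * (C (u n) - C e)) / (u n - e))) (Rabs (PI * k))).
{ intros C k HC.
  apply (is_lim_seq_abs _ (PI * k)).
  apply (lim_seq_quotient (fun t => sin (PI * (C t - C e)))); auto.
  - replace (PI * k) with (scal (PI * (k - 0)) (cos (PI * (C e - C e))))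
      by (rewrite Rminus_diag, Rmult_0_r, cos_0; unfold scal; simpl; unfold mult; simpl; ring).
    apply (is_derive_comp sin (fun t => PI * (C t - C e))).
    + apply is_derive_sin.
    + apply is_derive_scal. apply @is_derive_minus; [exact HC | apply @is_derive_const].
  - now rewrite Rminus_diag, Rmult_0_r, sin_0. }
assert (HA := Hgen A l Hd).
assert (HI := Hgen (fun t => t) 1 (is_derive_id e)).
assert (Hq : is_lim_seq (fun n => Rabs (sin (PI * (A (u n) - A e)) / (u n - e))
  / Rabs (sin (PI * (u n - e)) / (u n - e))) (Rabs (PI * l) / Rabs (PI * 1))).
{ apply is_lim_seq_div'; [exact HA | exact HI |].
  apply Rabs_no_R0. rewrite Rmult_1_r. lra. }
replace (Rabs l) with (Rabs (PI * l) / Rabs (PI * 1)).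
- apply is_lim_seq_ext with (2 := Hq). intros n. specialize (Hne n).
  unfold chord in *. unfold Rdiv. rewrite !Rabs_mult.
  assert (H1 : Rabs (/ (u n - e)) <> 0).
  { apply Rabs_no_R0, Rinv_neq_0_compat. intros E. apply (Hue n). lra. }
  field. now split.
- rewrite Rmult_1_r, Rabs_mult, (Rabs_pos_eq PI) by lra. field. lra.
Qed.

Lemma lim_seq_chord (A : R -> R) (e c : R) (u : nat -> R) :
  continuous A e -> is_lim_seq u e ->
  is_lim_seq (fun n => chord (A (u n)) c) (chord (A e) c).
Proof.
intros HA Hu. unfold chord. apply (is_lim_seq_abs _ (sin (PI * (A e - c)))).
apply (is_lim_seq_continuous (fun x => sin (PI * (x - c))) (fun n => A (u n)) (A e)).
- apply continuity_pt_filterlim.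
  apply (ex_derive_continuous (fun x => sin (PI * (x - c))) (A e)).
  auto_derive. exact I.
- apply (is_lim_seq_continuous A); [now apply continuity_pt_filterlim | exact Hu].
Qed.

(** Instead of proving that the integer [B (A t) - t] is constant: if [l = 0], some difference
    quotient of [B (A t)] at [e], with step [0 < h <= 1/2], is within 1/2 of 0, which places the
    change of this integer strictly between -1 and 0. *)
Lemma derive_nonzero (A B : R -> R) (e l m : R) :
  (forall t, exists k, B (A t) = t + IZR k) ->
  is_derive A e l -> is_derive B (A e) m -> l <> 0.
Proof.
intros HBA HA HB El. rewrite El in HA.
assert (HD := is_derive_comp B A e m 0 HB HA).
apply is_derive_Reals in HD. change (scal 0 m) with (0 * m) in HD.
rewrite Rmult_0_l in HD. destruct (HD (1/2) ltac:(lra)) as [del Hd].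
assert (Hp := cond_pos del). set (h := Rmin (del / 2) (1/2)).
assert (Hh : 0 < h) by (apply Rmin_pos; lra).
assert (Hh1 : h <= del / 2) by apply Rmin_l.
assert (Hh2 : h <= 1/2) by apply Rmin_r.
specialize (Hd h ltac:(lra)). rewrite (Rabs_pos_eq h) in Hd by lra.
specialize (Hd ltac:(lra)). rewrite Rminus_0_r in Hd.
destruct (HBA e) as [j Hj]. destruct (HBA (e + h)) as [k Hk].
rewrite Hj, Hk in Hd.
assert (E : (e + h + IZR k - (e + IZR j)) / h = 1 + IZR (k - j) / h)
  by (rewrite minus_IZR; field; lra).
rewrite E in Hd. apply Rabs_def2 in Hd. destruct Hd as [Hd1 Hd2].
assert (H1 : -2 < IZR (k - j) / h < 0) by lra.
assert (H2 : IZR (k - j) = IZR (k - j) / h * h) by (field; lra).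
assert (H3 : -1 < IZR (k - j) < 0) by (rewrite H2; nra).
assert (H4 : (-1 < k - j)%Z) by (apply lt_IZR; lra).
assert (H5 : (k - j < 0)%Z) by (apply lt_IZR; lra).
lia.
Qed.

(** * The coordinate [x = tan (PI * t)] on the upper half circle, with inverse [tau] *)

Definition tau (x : R) : R := atan x / PI.

Lemma cos_sin_tau (x : R) :
  cos (PI * tau x) = 1 / sqrt (1 + Rsqr x) /\ sin (PI * tau x) = x / sqrt (1 + Rsqr x).
Proof.
unfold tau. replace (PI * (atan x / PI)) with (atan x)
  by (field; generalize PI_RGT_0; lra).
split; [apply cos_atan | apply sin_atan].
Qed.

Lemma tau_bounds (x : R) : 0 < x -> 0 < tau x < 1/2.
Proof.
intros Hx. unfold tau. assert (HP := PI_RGT_0). generalize (atan_bound x). intros [_ H].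
assert (H1 := atan_increasing 0 x Hx). rewrite atan_0 in H1.
split; [now apply Rdiv_lt_0_compat |].
apply Rmult_lt_reg_r with PI; [lra |]. unfold Rdiv at 1.
rewrite Rmult_assoc, Rinv_l; lra.
Qed.

Lemma scaling_tau (a x : R) : 0 < a -> 0 < x -> scaling a (tau x) = tau (a * x).
Proof.
intros Ha Hx. assert (Hax : 0 < a * x) by now apply Rmult_lt_0_compat.
destruct (cos_sin_scaling a (tau x) Ha) as [E1 E2].
destruct (cos_sin_tau x) as [E3 E4]. destruct (cos_sin_tau (a * x)) as [E5 E6].
assert (HN := norm_scaling_pos a (tau x) Ha).
assert (Hq : 0 < sqrt (1 + Rsqr x)) by (apply sqrt_lt_R0; unfold Rsqr; nra).
assert (Hq2 : sqrt (1 + Rsqr (a * x)) = norm_scaling a (tau x) * sqrt (1 + Rsqr x)).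
{ rewrite <- (sqrt_Rsqr (norm_scaling a (tau x) * sqrt (1 + Rsqr x)))
    by (left; now apply Rmult_lt_0_compat).
  f_equal. rewrite !Rsqr_mult.
  change (Rsqr (norm_scaling a (tau x)))
    with (norm_scaling a (tau x) * norm_scaling a (tau x)).
  rewrite norm_scaling_sq by exact Ha.
  rewrite Rsqr_sqrt by (unfold Rsqr; nra). rewrite E3, E4.
  assert (Hs : sqrt (1 + Rsqr x) * sqrt (1 + Rsqr x) = 1 + Rsqr x)
    by (apply sqrt_sqrt; unfold Rsqr; nra).
  transitivity ((1 + a * a * (x * x)) / (sqrt (1 + Rsqr x) * sqrt (1 + Rsqr x)) * (1 + Rsqr x)).
  - rewrite Hs. unfold Rsqr. field. nra.
  - unfold Rdiv. field. lra. }
apply direction_inj.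
- rewrite E1, E3, E5, Hq2. field. lra.
- rewrite E2, E4, E6, Hq2. field. lra.
- assert (H1 := tau_bounds x Hx). assert (H2 := tau_bounds (a * x) Hax).
  assert (H3 := scaling_near a (tau x)). apply Rabs_def1; lra.
Qed.

Lemma height_tau (x : R) : height (tau x) = 2 * x / (1 + x * x).
Proof.
rewrite height_eq. destruct (cos_sin_tau x) as [-> ->].
assert (Hs : sqrt (1 + Rsqr x) * sqrt (1 + Rsqr x) = 1 + x * x)
  by (apply sqrt_sqrt; unfold Rsqr; nra).
assert (Hq : 0 < sqrt (1 + Rsqr x)) by (apply sqrt_lt_R0; unfold Rsqr; nra).
rewrite <- Hs. field. lra.
Qed.

Lemma height_tau_low (x : R) : 0 < x -> x <= 1/3 \/ 3 <= x -> height (tau x) <= 3/5.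
Proof.
intros Hx H. rewrite height_tau. apply Rmult_le_reg_r with (1 + x * x); [nra |].
replace (2 * x / (1 + x * x) * (1 + x * x)) with (2 * x) by (field; nra).
destruct H; nra.
Qed.

Lemma chord_tau (x : R) : 0 < x ->
  chord (tau x) 0 = x / sqrt (1 + Rsqr x) /\ chord (tau x) (1/2) = 1 / sqrt (1 + Rsqr x).
Proof.
intros Hx. destruct (cos_sin_tau x) as [E1 E2].
assert (Hq : 0 < sqrt (1 + Rsqr x)) by (apply sqrt_lt_R0; unfold Rsqr; nra).
unfold chord. rewrite Rminus_0_r, E2.
replace (PI * (tau x - 1/2)) with (- (PI / 2 - PI * tau x)) by field.
rewrite sin_neg, sin_shift, E1, Rabs_Ropp.
split; apply Rabs_pos_eq; left; apply Rdiv_lt_0_compat; lra.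
Qed.

Lemma lim_seq_tau_0 (u : nat -> R) : is_lim_seq u 0 -> is_lim_seq (fun n => tau (u n)) 0.
Proof.
intros Hu. replace 0 with (tau 0) by (unfold tau; rewrite atan_0; unfold Rdiv; ring).
apply (is_lim_seq_continuous tau); [| exact Hu].
apply continuity_pt_filterlim, (ex_derive_continuous tau 0).
unfold tau. exists (scal (/ PI) (/ (1 + Rsqr 0))).
apply (is_derive_ext (fun x => / PI * atan x)).
- intros t. unfold Rdiv. apply Rmult_comm.
- apply is_derive_scal, is_derive_atan.
Qed.

Lemma tau_inv (x : R) : 0 < x -> tau (/ x) = 1/2 - tau x.
Proof.
intros Hx. unfold tau. rewrite atan_inv by exact Hx. field.
generalize PI_RGT_0. lra.
Qed.

Lemma lim_geom_ninth (x : R) : is_lim_seq (fun n => x * (/ 9) ^ n) 0.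
Proof.
replace (Finite 0) with (Rbar_mult x 0) by (simpl; f_equal; ring).
apply is_lim_seq_scal_l, is_lim_seq_geom. rewrite Rabs_pos_eq; lra.
Qed.

Lemma scaling_at_half (a : R) : 0 < a -> scaling a (1/2) = 1/2.
Proof.
intros Ha. generalize (scaling_half a 0 Ha). rewrite scaling_0, Rplus_0_l. auto.
Qed.

(* [U / tan (PI * t)] is constant on either side of the fundamental domain, and
   the two constants agree at the point where [tan (PI * t)] is 3. *)
Lemma no_linearization (U : R -> R) (c r0 r1 : R) :
  (forall x, 0 < x -> U (Gl (tau x)) = c * U (tau x)) ->
  0 < c -> r0 <> 0 ->
  (forall x, 0 < x -> is_lim_seq (fun n => U (tau (x * (/ 9) ^ n)) / (x * (/ 9) ^ n)) r0) ->
  (forall x, 0 < x -> is_lim_seq (fun n => U (tau (/ (x * (/ 9) ^ n))) * (x * (/ 9) ^ n)) r1) ->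
  False.
Proof.
intros HU Hc Hr0 Hl0 Hl1.
assert (Hp : forall n, 0 < (/ 9) ^ n) by (intros n; apply pow_lt; lra).
assert (Hp1 : forall n, (/ 9) ^ n <= 1).
{ intros n. rewrite <- (pow1 n). apply pow_incr. lra. }
assert (Hstep : forall x, 0 < x -> x <= 1/3 \/ 3 <= x -> U (tau (9 * x)) = c * U (tau x)).
{ intros x Hx H. rewrite <- HU by exact Hx. unfold Gl.
  rewrite Kl_fixed by now apply height_tau_low. unfold Fl, Fpow.
  rewrite powerRZ_1, scaling_tau by lra. reflexivity. }
(* Consecutive terms of the sequence for [x = 1] have ratio [9 / c], and its limit [r0] is not 0. *)
assert (Hc9 : c = 9).
{ assert (H1 := Hl0 1 Rlt_0_1). assert (H2 := proj1 (is_lim_seq_incr_1 _ _) H1).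
  assert (H3 := is_lim_seq_scal_l _ (9 / c) _ H1).
  assert (E : Finite r0 = Rbar_mult (9 / c) r0).
  { rewrite <- (is_lim_seq_unique _ _ H3). rewrite <- (is_lim_seq_unique _ _ H2).
    apply Lim_seq_ext. intros n. simpl pow. set (p := (/ 9) ^ n).
    assert (Pp : 0 < p) by apply Hp. assert (Pp1 : p <= 1) by apply Hp1.
    replace (U (tau (1 * p))) with (U (tau (9 * (1 * (/ 9 * p)))))
      by (do 2 f_equal; field).
    rewrite (Hstep (1 * (/ 9 * p))) by lra. field. lra. }
  simpl in E. injection E. intros E'.
  assert (E2 : r0 * (9 - c) = 0).
  { transitivity (c * (9 / c * r0 - r0)); [field; lra | rewrite <- E'; ring]. }
  apply Rmult_integral in E2. lra. }
subst c.
(* The points [x / 9 ^ (n + 1)] are at most 1/3, where k is the identity, so the sequence is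
   constant and equals its limit. *)
assert (Hlow : forall x, 0 < x <= 3 -> U (tau x) = r0 * x).
{ intros x Hx. assert (H := Hl0 x (proj1 Hx)).
  assert (Hn : forall n, U (tau (x * (/ 9) ^ n)) / (x * (/ 9) ^ n) = U (tau x) / x).
  { intros n. induction n as [|n IH]; [simpl; now rewrite Rmult_1_r |].
    rewrite <- IH. simpl pow. set (p := (/ 9) ^ n).
    assert (Pp : 0 < p) by apply Hp. assert (Pp1 : p <= 1) by apply Hp1.
    replace (U (tau (x * p))) with (U (tau (9 * (x * (/ 9 * p)))))
      by (do 2 f_equal; field).
    rewrite (Hstep (x * (/ 9 * p))) by nra. field. lra. }
  assert (H2 := is_lim_seq_ext _ _ _ Hn H).
  assert (H3 := is_lim_seq_unique _ _ H2). rewrite Lim_seq_const in H3.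
  injection H3. intros <-. field. lra. }
assert (Hhigh : forall x, 3 <= x -> U (tau x) = r1 * x).
{ intros x Hx. assert (Hix : 0 < / x) by (apply Rinv_0_lt_compat; lra).
  assert (H := Hl1 (/ x) Hix).
  assert (Hn : forall n, U (tau (/ (/ x * (/ 9) ^ n))) * (/ x * (/ 9) ^ n) = U (tau x) * / x).
  { intros n. induction n as [|n IH].
    - simpl. now rewrite Rmult_1_r, Rinv_inv.
    - rewrite <- IH. simpl pow. set (p := (/ 9) ^ n).
      assert (Pp : 0 < p) by apply Hp. assert (Pp1 : p <= 1) by apply Hp1.
      replace (/ (/ x * (/ 9 * p))) with (9 * / (/ x * p)) by (field; lra).
      assert (Hip : 1 <= / p) by (rewrite <- Rinv_1; apply Rinv_le_contravar; lra).
      assert (E : / (/ x * p) = x * / p) by (field; lra).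
      rewrite (Hstep (/ (/ x * p))) by (rewrite E; nra). field. lra. }
  assert (H2 := is_lim_seq_ext _ _ _ Hn H).
  assert (H3 := is_lim_seq_unique _ _ H2). rewrite Lim_seq_const in H3.
  injection H3. intros <-. field. lra. }
assert (Er : r1 = r0).
{ generalize (Hlow 3 ltac:(lra)) (Hhigh 3 ltac:(lra)). lra. }
assert (Ht1 : tau 1 = 1/4).
{ unfold tau. rewrite atan_1. field. generalize PI_RGT_0. lra. }
set (k := Kl (1/4)).
assert (Hk : 1/4 < k < 1/2).
{ unfold k, Kl.
  assert (E : height (1/4) = 1).
  { unfold height. replace (2 * PI * (1/4)) with (PI / 2) by field. apply sin_PI2. }
  rewrite E. generalize (flat_bound 0 (1 - 3/5)). simpl. intros H.
  assert (0 < flat 0 (1 - 3/5)).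
  { unfold flat. destruct (Rlt_dec 0 (1 - 3/5)); [| lra].
    simpl. rewrite Rmult_1_l. apply exp_pos. }
  lra. }
assert (Hy : exists y, tau y = k).
{ exists (tan (PI * k)). unfold tau. assert (HP := PI_RGT_0).
  rewrite atan_tan by nra. field. lra. }
destruct Hy as [y Hy].
assert (Hy1 : 1 < y).
{ apply Rnot_le_lt. intros H. assert (HP := PI_RGT_0).
  assert (Hle : atan y <= atan 1).
  { destruct H as [H | H]; [left; now apply atan_increasing | rewrite H; lra]. }
  assert (tau y <= tau 1); [| lra].
  unfold tau. apply Rmult_le_compat_r; [left; now apply Rinv_0_lt_compat | exact Hle]. }
(* k moves the point [x = 1] to [y > 1]. As 1 lies below 3 and [9 * y] above it, the relation at 1
   reads [r1 * (9 * y) = 9 * r0], and [r1 = r0] forces [y = 1]. *)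
assert (H := HU 1 Rlt_0_1). unfold Gl in H. rewrite Ht1 in H. fold k in H.
rewrite <- Hy in H. rewrite <- Ht1 in H. unfold Fl, Fpow in H.
rewrite powerRZ_1, scaling_tau in H by lra.
rewrite (Hhigh (9 * y)) in H by lra. rewrite (Hlow 1) in H by lra. rewrite Er in H.
assert (E : r0 * (y - 1) = 0) by lra. apply Rmult_integral in E. lra.
Qed.

(** [B] lifts [psi] and [A] lifts its inverse. The conjugacy turns f_2 into some [gam] of the first
    group, a Moebius map fixing the points [P] and [Q] with lifts [A 0] and [A (1/2)]. The function
    [|z - P| / |z - Q|], at the point [z] with lift [A t], is the [U] of [no_linearization]; the
    derivatives of [A] at 0 and 1/2 give the two limits. *)
Lemma no_C1_conjugacy : ~ (exists psi : circle -> circle,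
  Ck_diffeo 1 psi /\ orientation_preserving psi /\
  conjugates psi (generated gens1) (generated gens2)).
Proof.
intros [psi [[psi' [Inv [[B [[_ LB] [DB _]]] [A [[CA LA] [DA _]]]]]] [_ [psi2 [Inv2 Hc]]]]].
assert (E := inverses_unique _ _ _ Inv2 Inv). subst psi2.
destruct Inv as [I1 I2].
destruct (proj1 (Hc (circ Gl)) (gen_in gens2 _ (or_introl eq_refl))) as [gam [Hg Eg]].
assert (Hgam : forall t, gam (cover (A t)) = cover (A (Gl t))).
{ intros t. rewrite <- !LA, <- (circ_cover Gl) by auto.
  rewrite Eg. now rewrite I1. }
destruct (moebius_generated gam Hg) as [dl [Hd Em]].
assert (HM : forall s t, chord (A (Gl s)) (A (Gl t)) =
  chord (A s) (A t) * dl (cover (A s)) * dl (cover (A t))).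
{ intros s t. generalize (Em (cover (A s)) (cover (A t))).
  rewrite !Hgam, !circle_dist_cover. lra. }
assert (Hinj : forall s t, 0 < chord s t -> 0 < chord (A s) (A t)).
{ intros s t H. destruct (chord_nonneg (A s) (A t)) as [H1 | H1]; [exact H1 |].
  exfalso. symmetry in H1. apply chord_0 in H1. destruct H1 as [k Hk].
  assert (Ec : cover s = cover t).
  { rewrite <- (I2 (cover s)), <- (I2 (cover t)), !LA, Hk. now rewrite cover_add_IZR. }
  generalize (circle_dist_cover s t). rewrite Ec, circle_dist_cover.
  unfold chord at 1. rewrite Rminus_diag, Rmult_0_r, sin_0, Rabs_R0. lra. }
assert (HBA : forall t, exists k, B (A t) = t + IZR k).
{ intros t. apply cover_eq. now rewrite <- LB, <- LA, I2. }
assert (HdA : forall e, is_derive A e (Derive A e))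
  by (intros e; apply Derive_correct; exact (DA 1%nat e (le_n 1))).
assert (HdB : forall e, is_derive B e (Derive B e))
  by (intros e; apply Derive_correct; exact (DB 1%nat e (le_n 1))).
assert (Hne : forall e, Derive A e <> 0)
  by (intros e; exact (derive_nonzero A B e _ _ HBA (HdA e) (HdB (A e)))).
assert (Hhalf : height (1/2) = 0).
{ unfold height. replace (2 * PI * (1/2)) with PI by field. apply sin_PI. }
assert (G0 : Gl 0 = 0).
{ unfold Gl. rewrite Kl_fixed by (rewrite height_0; lra). apply scaling_0. }
assert (G1 : Gl (1/2) = 1/2).
{ unfold Gl. rewrite Kl_fixed by (rewrite Hhalf; lra). apply scaling_at_half, pow9_pos. }
assert (C01 : chord 0 (1/2) = 1).
{ unfold chord. replace (PI * (0 - 1/2)) with (- (PI / 2)) by field.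
  rewrite sin_neg, sin_PI2, Rabs_Ropp. apply Rabs_R1. }
assert (HPQ : 0 < chord (A 0) (A (1/2))) by (apply Hinj; lra).
assert (Hct : forall x, 0 < x -> 0 < chord (tau x) 0 /\ 0 < chord (tau x) (1/2)).
{ intros x Hx. destruct (chord_tau x Hx) as [-> ->].
  assert (Hq : 0 < sqrt (1 + Rsqr x)) by (apply sqrt_lt_R0; unfold Rsqr; nra).
  split; apply Rdiv_lt_0_compat; lra. }
assert (Hx : forall x, 0 < x -> chord (tau x) 0 / chord (tau x) (1/2) = x).
{ intros x Hx. destruct (chord_tau x Hx) as [-> ->].
  assert (Hq : 0 < sqrt (1 + Rsqr x)) by (apply sqrt_lt_R0; unfold Rsqr; nra).
  field. lra. }
assert (Hp : forall n, 0 < (/ 9) ^ n) by (intros n; apply pow_lt; lra).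
(* In half chordal distances, the limits are [|A'(0)| / |P - Q|] and [|P - Q| / |A'(1/2)|]. *)
apply (no_linearization (fun t => chord (A t) (A 0) / chord (A t) (A (1/2)))
  (dl (cover (A 0)) / dl (cover (A (1/2))))
  (Rabs (Derive A 0) * (1 / chord (A 0) (A (1/2))))
  (chord (A (1/2)) (A 0) * / Rabs (Derive A (1/2)))).
(* The factor [dl] at the moving point is common to numerator and denominator and cancels. *)
- intros x H. cbv beta. assert (E0 := HM (tau x) 0). assert (E1 := HM (tau x) (1/2)).
  rewrite G0 in E0. rewrite G1 in E1. rewrite E0, E1.
  assert (H1 := Hinj _ _ (proj2 (Hct x H))).
  assert (H2 := Hd (cover (A (tau x)))). assert (H3 := Hd (cover (A (1/2)))).
  field. lra.
- apply Rdiv_lt_0_compat; apply Hd.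
- apply Rmult_integral_contrapositive. split; [now apply Rabs_no_R0 |].
  unfold Rdiv. rewrite Rmult_1_l. apply Rinv_neq_0_compat. lra.
- intros x H.
  assert (Hpos : forall n, 0 < x * (/ 9) ^ n) by (intros n; now apply Rmult_lt_0_compat).
  assert (Hl := lim_seq_tau_0 _ (lim_geom_ninth x)).
  assert (L1 := lim_seq_chord_quotient A 0 _ _ (HdA 0) Hl
    (fun n => Rgt_not_eq _ _ (proj1 (Hct _ (Hpos n))))).
  assert (L2 := lim_seq_chord A 0 (A (1/2)) _ (CA 0) Hl).
  assert (L3 := lim_seq_chord (fun t => t) 0 (1/2) _ (continuous_id 0) Hl).
  cbv beta in L3.
  assert (L4 := is_lim_seq_div' _ _ _ _ L3 L2 ltac:(lra)). rewrite C01 in L4.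
  (* By [Hx], dividing by [x * (/ 9) ^ n] is dividing by the same chord ratio without [A]. This
     splits the sequence into a chord quotient tending to [|A'(0)|] and a factor whose limit comes
     from continuity. *)
  apply is_lim_seq_ext with (2 := is_lim_seq_mult' _ _ _ _ L1 L4).
  intros n. cbv beta. set (y := x * (/ 9) ^ n). assert (Py : 0 < y) by apply Hpos.
  assert (H1 := Hinj _ _ (proj2 (Hct y Py))). destruct (Hct y Py) as [H2 H3].
  transitivity (chord (A (tau y)) (A 0) / chord (A (tau y)) (A (1/2))
    / (chord (tau y) 0 / chord (tau y) (1/2))); [field; lra | now rewrite (Hx y Py)].
- intros x H.
  assert (Hpos : forall n, 0 < / (x * (/ 9) ^ n))
    by (intros n; apply Rinv_0_lt_compat; now apply Rmult_lt_0_compat).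
  assert (Hl : is_lim_seq (fun n => tau (/ (x * (/ 9) ^ n))) (1/2)).
  { apply (is_lim_seq_ext (fun n => 1/2 - tau (x * (/ 9) ^ n))).
    - intros n. symmetry. apply tau_inv. now apply Rmult_lt_0_compat.
    - replace (Finite (1/2)) with (Finite (1/2 - 0)) by (f_equal; ring).
      apply is_lim_seq_minus'; [apply is_lim_seq_const |].
      apply lim_seq_tau_0, lim_geom_ninth. }
  assert (L1 := lim_seq_chord_quotient A (1/2) _ _ (HdA (1/2)) Hl
    (fun n => Rgt_not_eq _ _ (proj2 (Hct _ (Hpos n))))).
  assert (L1' := is_lim_seq_inv _ _ L1 ltac:(intros Q; injection Q; apply Rabs_no_R0, Hne)).
  assert (L2 := lim_seq_chord A (1/2) (A 0) _ (CA (1/2)) Hl).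
  assert (L3 := lim_seq_chord (fun t => t) (1/2) 0 _ (continuous_id (1/2)) Hl).
  cbv beta in L3.
  rewrite (chord_sym (1/2) 0), C01 in L3.
  assert (L4 := is_lim_seq_div' _ _ _ _ L2 L3 ltac:(lra)).
  assert (L5 := is_lim_seq_mult' _ _ _ _ L4 L1').
  replace (chord (A (1/2)) (A 0) / 1) with (chord (A (1/2)) (A 0)) in L5 by field.
  apply is_lim_seq_ext with (2 := L5).
  intros n. cbv beta. assert (Pn := Hpos n).
  set (y := / (x * (/ 9) ^ n)) in *.
  assert (Ey : x * (/ 9) ^ n = / y) by (unfold y; now rewrite Rinv_inv).
  assert (H1 := Hinj _ _ (proj2 (Hct y Pn))). destruct (Hct y Pn) as [H2 H3].
  transitivity (chord (A (tau y)) (A 0) / chord (A (tau y)) (A (1/2))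
    * / (chord (tau y) 0 / chord (tau y) (1/2))); [field; lra | now rewrite (Hx y Pn), Ey].
Qed.

Theorem theoremC :
  exists G1 G2 : (circle -> circle) -> Prop,
    (smooth_diffeo_group G1 /\ finitely_generated G1 /\
     acts_non_freely G1 /\ without_finite_orbits G1) /\
    (smooth_diffeo_group G2 /\ finitely_generated G2 /\
     acts_non_freely G2 /\ without_finite_orbits G2) /\
    (exists phi : circle -> circle,
       bilipschitz_homeo phi /\ orientation_preserving phi /\
       conjugates phi G1 G2) /\
    ~ (exists psi : circle -> circle,
         Ck_diffeo 1 psi /\ orientation_preserving psi /\
         conjugates psi G1 G2).
Proof.
exists (generated gens1), (generated gens2).
exact (conj group1 (conj group2 (conj bilipschitz_conjugacy no_C1_conjugacy))).
Qed.
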